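(* Let $r\ge2$ be an integer and let $q_0,q_1,\dots,q_{r-1}$ be the fixed real coefficients (independent of $h$) defining the quasiinterpolant $Q_h$ in $\mathcal{S}_h^r$, where $h=1/N$ and $N\ge4r$ is an integer. Then: (i) There exists a constant $C_0$ independent of $h$ such that $\|Q_hu\|_\infty\le C_0\|u\|_\infty$ for all $u\in C_{per}$. Moreover, for each $l=1,2,\dots,r-1$ there exist constants $C_1, C_2$ depending only on $l$ and $r$ (the coefficients $q_0,\dots,q_{r-1}$ being fixed once and for all for the given $r$; in particular $C_1,C_2$ do not depend on $h$ or $u$) such that (ii) $\|\partial_x^l(Q_hu)\|_\infty\le C_1\|\partial_x^lu\|_\infty$ if $u\in W^l_\infty\cap H^l_{per}$, and (iii) $\|\partial_x^l(Q_hu)\|\le C_2\|\partial_x^lu\|$ if $u\in H^l_{per}$.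
   Context: Let $r\ge2$, $N\ge4r$ be integers, $h=1/N$, $x_i=ih$ for $i=0,1,\dots,N$. Let $C^k_{per}$ be the space of $1$-periodic, $k$ times continuously differentiable functions ($C_{per}=C^0_{per}$), and $C^{k}_{per}[0,1]$ the restrictions of such functions to $[0,1]$. Let $\mathbb{P}_m$ denote the polynomials of degree at most $m$. Define the $N$-dimensional spline space $$\mathcal{S}_h^r=\{v\in C^{r-2}_{per}[0,1] : v|_{(x_{i-1},x_i)}\in\mathbb{P}_{r-1},\ i=1,2,\dots,N\}.$$ Standard basis: let $v_1$ be the characteristic function of $[-\tfrac12,\tfrac12]$ and $v_r$ the convolution of $v_1$ with itself $r-1$ times (the $B$-spline of order $r$, supported in $[-\tfrac r2,\tfrac r2]$). Put $\phi_l(x)=v_r(h^{-1}x-l-\tfrac{r-2}{2})$ for $l\in\mathbb{Z}$, and $\Phi_j(x)=\sum_{l\in\mathbb{Z}}\phi_{j+lN}(x)$ for $j\in\mathbb{Z}$, so that $\Phi_{j+N}=\Phi_j$. The restrictions of $\{\Phi_j\}_{j=1}^N$ to $[0,1]$ form a basis of $\mathcal{S}_h^r$. Quasiinterpolant: given real coefficients $q_0,\dots,q_{r-1}$, independent of $h$, let $\widetilde\Phi_j=q_0\Phi_j+\sum_{k=1}^{r-1}q_k(\Phi_{j+k}+\Phi_{j-k})$, $j=1,\dots,N$, where the coefficients are such that $\{\widetilde\Phi_j\}_{j=1}^N$ is a (modified) basis of $\mathcal{S}_h^r$. For a continuous $1$-periodic function $u$ the quasiinterpolant of $u$ in $\mathcal{S}_h^r$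 is $$Q_hu=\sum_{j=1}^N u(jh)\,\widetilde\Phi_j .$$ $\|\cdot\|$ and $\|\cdot\|_\infty$ denote the $L^2$ and $L^\infty$ norms on $[0,1]$. For integer $l\ge1$, $H^l_{per}$ is the $L^2$-based Sobolev space of order $l$ of $1$-periodic functions (whose elements are identified with their continuous representatives), and $W^l_\infty$ is the $L^\infty$-based Sobolev space of order $l$. Derivatives $\partial_x^l$ are weak derivatives; for elements of $\mathcal{S}_h^r$ and $l\le r-1$ they coincide with the piecewise (on each $(x_{i-1},x_i)$) derivatives. *)

(* Defs.v *)
From mathcomp Require Export all_boot all_order all_algebra.
From mathcomp Require Export all_classical all_reals all_analysis.

Set Implicit Arguments.
Unset Strict Implicit.
Unset Printing Implicit Defensive.
Import Order.TTheory GRing.Theory Num.Theory.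
Import numFieldNormedType.Exports.

Local Open Scope classical_set_scope.
Local Open Scope ring_scope.

Section FunctionSpaces.
Context {R : realType}.
Implicit Types (u v g phi : R -> R) (k l : nat) (p : \bar R).

Definition unit_measure : {measure set (measurableTypeR R) -> \bar R} :=
  mrestr (@lebesgue_measure R) (measurable_itv `[0, 1]).

Definition Lpnorm p u : \bar R := Lnorm unit_measure p (EFin \o u).

(* Functions on [0,1] that are restrictions of 1-periodic functions are
   represented by the 1-periodic functions on the whole line. *)
Definition Cper k u : Prop :=
  [/\ periodic u 1,
      (forall i, (i < k)%N -> forall x, derivable (derive1n i u) x 1) &
      (forall i, (i <= k)%N -> continuous (derive1n i u))].

Definition Cper_infty u : Prop := forall k, Cper k u.

(* Weak derivatives of 1-periodic functions, tested against smooth 1-periodic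
   functions; such a g is unique up to equality almost everywhere. *)
Definition is_weak_deriv k u g : Prop :=
  [/\ periodic g 1,
      g \in Lfun unit_measure 1%:E &
      forall phi, Cper_infty phi ->
        \int[@lebesgue_measure R]_(x in `[0, 1]) (u x * derive1n k phi x) =
        (-1) ^+ k * \int[@lebesgue_measure R]_(x in `[0, 1]) (g x * phi x)].

(* Elements of positive-order Sobolev spaces are identified with their
   continuous representatives; this is to be used with l >= 1 only. *)
Definition Sobolev_per l p u : Prop :=
  Cper 0 u /\
  (forall k, (k <= l)%N ->
     exists2 g, is_weak_deriv k u g & g \in Lfun unit_measure p).

Definition H_per l u := Sobolev_per l 2%:E u.
(* The 1-periodic elements of the L^infty-based Sobolev space of order l. *)
Definition W_infty l u := Sobolev_per l +oo%E u.

Definition is_basis (S : set (R -> R)) (n : nat) (b : 'I_n -> R -> R) : Prop :=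
  [/\ (forall j, S (b j)),
      (forall c : 'I_n -> R,
         (forall x, \sum_j c j * b j x = 0) -> forall j, c j = 0) &
      (forall v, S v ->
         exists c : 'I_n -> R, forall x, v x = \sum_j c j * b j x)].

End FunctionSpaces.

Section Splines.
Context {R : realType}.
Implicit Types (r N : nat) (q : nat -> R) (u : R -> R).

Definition mesh N : R := N%:R^-1.

Definition spline_space r N : set (R -> R) :=
  [set v | Cper (r - 2) v /\
    forall i, (i < N)%N -> exists2 p : {poly R}, (size p <= r)%N &
      forall x, i%:R * mesh N < x < i.+1%:R * mesh N -> v x = p.[x] ].

Definition convolution (f g : R -> R) (x : R) : R :=
  \int[@lebesgue_measure R]_y (f y * g (x - y)).

Definition bspline1 : R -> R := \1_(`[- 2^-1, 2^-1]%classic).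

Definition bspline r : R -> R :=
  iter r.-1 (fun f => convolution f bspline1) bspline1.

Definition phi_ r N (l : int) (x : R) : R :=
  bspline r ((mesh N)^-1 * x - l%:~R - (r%:R - 2) / 2).

(* A finitely supported sum for each x, since bspline r has compact support. *)
Definition Phi_ r N (j : int) (x : R) : R :=
  \sum_(l \in [set: int]) phi_ r N (j + l * N%:Z) x.

(* Only the values q 0, ..., q (r - 1) matter. *)
Definition tPhi r N q (j : int) (x : R) : R :=
  q 0%N * Phi_ r N j x +
  \sum_(1 <= k < r) q k * (Phi_ r N (j + k%:Z) x + Phi_ r N (j - k%:Z) x).

Definition quasi_interp r N q u (x : R) : R :=
  \sum_(1 <= j < N.+1) u (j%:R * mesh N) * tPhi r N q j%:Z x.

(* The ordinal i < N stands for the index j = i + 1. *)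
Definition tPhi_is_basis r N q : Prop :=
  is_basis (spline_space r N) (fun i : 'I_N => tPhi r N q i.+1%:Z).

End Splines.

(* Main.v *)
Require Import Defs.
From mathcomp Require Import ess_sup_inf measurable_realfun lra ring zify.
Import Order.TTheory GRing.Theory Num.Theory.
Import numFieldNormedType.Exports.

Local Open Scope ring_scope.

(** With [h = 1/N], let [avg h f x] be the integral of [f] over [[x, x + h]].
    Averaging and differencing control both sides of the estimate.

    Output side: the periodized B-splines satisfy [B_(n+1) = avg 1 B_n] up to a
    shift, and by Fubini the weak derivative of [avg h f] is [f (x + h) - f x].
    Hence the [l]-th derivative of [Q_h u] is [N ^ l] times the same spline
    series with order [r - l] and with coefficients the [l]-th backward
    differences of the samples of [u].  Since the B-splines are nonnegative and
    their translates sum to at most [2], this series is bounded, in the sup norm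
    and in the L^2 norm, by its coefficients.

    Input side: testing the weak derivative [g] of [u] against the [l]-fold
    average of an approximate identity [rho] centred at [x_m] gives
    [\int (bdiff^l u) rho = \int g (avg^l rho)].  The weight [avg^l rho] is
    nonnegative of mass [h ^ l], and its [N] translates by multiples of [h] sum
    to the constant [h ^ (l - 1)]; so the sup bound is immediate, and
    Cauchy-Schwarz with weight [avg^l rho], summed over [m], gives
    [\sum_m (bdiff^l u (x_m)) ^ 2 <= h ^ (2 l - 1) \int g ^ 2]. *)

(** * Integrals of bounded measurable functions *)

Section BoundedMeasurable.
Local Open Scope classical_set_scope.
Context {R : realType}.
Implicit Types (f g : R -> R) (a b c k : R).
Local Notation mu := (@lebesgue_measure R).

Definition intab a b f : R := \int[mu]_(x in `[a, b]) f x.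

(** Boundedness is required everywhere, not almost everywhere: the class is then stable under sums,
    products, shifts and averages, and integrability on compact intervals is automatic. *)
Definition bmeas f : Prop :=
  measurable_fun setT f /\ exists M, forall x, `|f x| <= M.

Lemma bmeas_integrable f a b : bmeas f -> mu.-integrable `[a, b] (EFin \o f).
Proof.
move=> [mf [M fM]]; apply: measurable_bounded_integrable => //.
- by rewrite /= lebesgue_measure_itv /=; case: ifP => // _; rewrite ltry.
- exact: measurable_funS mf.
- exists M; split; first exact: num_real.
  by move=> x Mx y _ /=; rewrite (le_trans (fM y))// ltW.
Qed.

Lemma bmeas_cst c : bmeas (cst c).
Proof. by split; [exact: measurable_cst|exists `|c|]. Qed.

Lemma bmeasD f g : bmeas f -> bmeas g -> bmeas (fun x => f x + g x).
Proof.
move=> [mf [M fM]] [mg [M' gM']]; split; first exact: measurable_funD.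
by exists (M + M') => x; rewrite (le_trans (ler_normD _ _))// lerD.
Qed.

Lemma bmeasM f g : bmeas f -> bmeas g -> bmeas (fun x => f x * g x).
Proof.
move=> [mf [M fM]] [mg [M' gM']]; split; first exact: measurable_funM.
by exists (M * M') => x; rewrite normrM ler_pM.
Qed.

Lemma bmeasZ c f : bmeas f -> bmeas (fun x => c * f x).
Proof. by move=> bf; apply: (bmeasM (cst c)) => //; exact: bmeas_cst. Qed.

Lemma bmeasB f g : bmeas f -> bmeas g -> bmeas (fun x => f x - g x).
Proof.
move=> bf bg; have := bmeasD _ _ bf (bmeasZ (-1) _ bg).
by under eq_fun do rewrite mulN1r.
Qed.

Lemma bmeas_sum (I : Type) (s : seq I) (F : I -> R -> R) :
  (forall i, bmeas (F i)) -> bmeas (fun x => \sum_(i <- s) F i x).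
Proof.
move=> bF; elim: s => [|i s ih].
  by under eq_fun do rewrite big_nil; exact: (bmeas_cst 0).
by under eq_fun do rewrite big_cons; exact: bmeasD.
Qed.

Lemma bmeas_affine k c f : bmeas f -> bmeas (fun x => f (k * x + c)).
Proof.
move=> [mf [M fM]]; split; last by exists M.
by apply: (measurableT_comp mf); apply: measurable_funD.
Qed.

Lemma bmeas_shift c f : bmeas f -> bmeas (fun x => f (x + c)).
Proof.
by move=> /(bmeas_affine 1 c); under eq_fun do rewrite mul1r.
Qed.

Lemma bmeas_shiftB c f : bmeas f -> bmeas (fun x => f (x - c)).
Proof. exact: bmeas_shift. Qed.

Lemma intabD a b f g : bmeas f -> bmeas g ->
  intab a b (fun x => f x + g x) = intab a b f + intab a b g.
Proof. by move=> bf bg; apply: RintegralD => //; exact: bmeas_integrable. Qed.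

Lemma intabB a b f g : bmeas f -> bmeas g ->
  intab a b (fun x => f x - g x) = intab a b f - intab a b g.
Proof. by move=> bf bg; apply: RintegralB => //; exact: bmeas_integrable. Qed.

Lemma intabZ a b c f : bmeas f ->
  intab a b (fun x => c * f x) = c * intab a b f.
Proof. by move=> bf; apply: RintegralZl => //; exact: bmeas_integrable. Qed.

Lemma intab_cst a b c : a <= b -> intab a b (cst c) = c * (b - a).
Proof.
move=> ab; rewrite /intab Rintegral_cst//= lebesgue_measure_itv/= lte_fin.
by move: ab; rewrite le_eqVlt => /predU1P[->|->//]; rewrite ltxx subrr.
Qed.

Lemma intab_sum (I : Type) (s : seq I) (F : I -> R -> R) a b :
  a <= b -> (forall i, bmeas (F i)) ->
  intab a b (fun x => \sum_(i <- s) F i x) = \sum_(i <- s) intab a b (F i).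
Proof.
move=> ab bF; elim: s => [|i s ih].
  under eq_fun do rewrite big_nil; rewrite big_nil.
  by rewrite -[LHS]/(intab a b (cst 0)) intab_cst// mul0r.
under eq_fun do rewrite big_cons; rewrite big_cons -ih.
by rewrite intabD//; exact: bmeas_sum.
Qed.

Lemma intab_ge0 a b f : (forall x, 0 <= f x) -> 0 <= intab a b f.
Proof. by move=> f0; exact: Rintegral_ge0. Qed.

Lemma le_intab a b f g : bmeas f -> bmeas g ->
  (forall x, a <= x <= b -> f x <= g x) -> intab a b f <= intab a b g.
Proof.
move=> bf bg fg.
apply: (le_Rintegral _ (bmeas_integrable _ _ _ bf) (bmeas_integrable _ _ _ bg)).
  exact: measurable_itv.
by move=> x /=; rewrite in_itv /=; exact: fg.
Qed.

Lemma eq_intab a b f g : (forall x, a <= x <= b -> f x = g x) ->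
  intab a b f = intab a b g.
Proof.
by move=> fg; apply: eq_Rintegral => x; rewrite inE /= in_itv/=; exact: fg.
Qed.

Lemma le_normr_intab a b f : bmeas f ->
  `|intab a b f| <= intab a b (fun x => `|f x|).
Proof. by move=> bf; apply: le_normr_Rintegral => //; exact: bmeas_integrable. Qed.

Lemma intab_split a b c f : bmeas f -> a <= c -> c <= b ->
  intab a b f = intab a c f + intab c b f.
Proof.
move=> bf ac cb.
have := @Rintegral_itvB R f (BLeft a) (BRight b) c (bmeas_integrable _ _ _ bf).
rewrite !bnd_simp => /(_ ac cb) /eqP; rewrite subr_eq => /eqP.
rewrite /intab => ->; rewrite addrC; congr (_ + _).
apply: Rintegral_itv_obnd_cbnd.
apply: integrableS (bmeas_integrable f c b bf) => //.
by apply: subset_itv; rewrite bnd_simp.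
Qed.

(** Lebesgue measure agrees with [k] times its pushforward under [t |-> k * t + c] on half-open
    intervals, hence on all measurable sets by uniqueness. For nonnegative integrands the
    pushforward formula then gives the change of variables. *)
Lemma ge0_intab_affine k c a b f : 0 < k -> bmeas f -> (forall x, 0 <= f x) ->
  intab (k * a + c) (k * b + c) f = k * intab a b (fun t => f (k * t + c)).
Proof.
move=> k0 bf f0.
pose aff (t : measurableTypeR R) : measurableTypeR R := k * t + c.
have maff : measurable_fun setT aff by apply: measurable_funD.
(* The instance takes the measurability proof as an argument, which unification
   cannot find, so it is named explicitly. *)
pose pf : {measure set (measurableTypeR R) -> \bar R} :=
  measure_function_pushforward__canonical__measure_function_Measure mu maff.
pose nu := mscale (NngNum (ltW k0)) pf.
have nuE (A : set (measurableTypeR R)) : measurable A -> mu A = nu A.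
  move=> mA; apply: lebesgue_measure_unique => //= _ [[x y]] _ <-.
  rewrite /nu /mscale /= /pushforward /=.
  rewrite (_ : _ @^-1` _ = `](x - c) / k, (y - c) / k]%classic).
    rewrite !lebesgue_measure_itv/= !lte_fin ltr_pM2r ?invr_gt0// ltrD2r.
    case: ifP => _; rewrite ?mule0// -!EFinB -EFinM; congr (_%:E).
    by field; rewrite gt_eqF.
  apply/seteqP; split=> t /=; rewrite !in_itv/= ltr_pdivrMr// ler_pdivlMr//;
    by rewrite ltrBlDr lerBrDr mulrC.
have mf : measurable_fun setT (EFin \o f) by apply/measurable_EFinP; case: bf.
rewrite /intab /Rintegral (eq_measure_integral nu); last by move=> A mA _; exact: nuE.
rewrite ge0_integral_mscale//; last 2 first.
- exact: measurable_funS mf.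
- by move=> x _; rewrite lee_fin.
rewrite ge0_integral_pushforward//; last 2 first.
- exact: measurable_funS mf.
- by move=> x _; rewrite lee_fin.
rewrite (_ : _ @^-1` _ = `[a, b]%classic); last first.
  by apply/seteqP; split=> t /=; rewrite !in_itv/= !lerD2r !ler_pM2l.
rewrite fineM//.
by apply: integrable_fin_num => //; exact/bmeas_integrable/bmeas_affine.
Qed.

(** Adding a bound [M] of [|f|] reduces to the nonnegative case; the two integrals of the constant
    [M] then cancel. *)
Lemma intab_affine k c a b f : 0 < k -> bmeas f ->
  intab (k * a + c) (k * b + c) f = k * intab a b (fun t => f (k * t + c)).
Proof.
move=> k0 bf; have [mf [M fM]] := bf.
have bM := bmeas_cst M.
have bfM := bmeasD _ _ bf bM.
have := ge0_intab_affine k c a b _ k0 bfM.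
rewrite !intabD//; last exact: bmeas_affine.
have -> : intab (k * a + c) (k * b + c) (cst M) = k * intab a b (fun=> M).
  have := ge0_intab_affine k c a b _ k0 (bmeas_cst `|M|).
  have [M0|M0] := leP 0 M; first by rewrite ger0_norm// => ->.
  have := fM 0; have := normr_ge0 (f 0); lra.
rewrite mulrDr => /(_ _)/addIr; apply => x.
by rewrite -lerBlDr sub0r; have /lerNnormlW := fM x.
Qed.

Lemma intab_shift c a b f : bmeas f ->
  intab (a + c) (b + c) f = intab a b (fun t => f (t + c)).
Proof.
move=> bf; have := intab_affine 1 c a b f ltr01 bf.
by rewrite !mul1r => ->; apply: eq_intab => x _; rewrite mul1r.
Qed.

Lemma periodic_int f : periodic f 1 -> forall (z : int) x, f (x + z%:~R) = f x.
Proof.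
move=> pf; have pn n x : f (x + n%:R) = f x by rewrite periodicn.
by move=> [n|n] x; [exact: pn|rewrite NegzE mulrNz -(pn n.+1) subrK].
Qed.

Lemma intab_periodic f c : bmeas f -> periodic f 1 ->
  intab 0 1 (fun t => f (t + c)) = intab 0 1 f.
Proof.
move=> bf pf.
(* Only the fractional part of [c] matters. The window from [d] to [1 + d] is cut at [1], and the
   piece beyond [1] is moved back by one period. *)
pose d := c - (Num.floor c)%:~R.
have d0 : 0 <= d by rewrite subr_ge0 floor_le.
have d1 : d <= 1.
  by have := floorD1_gt c; rewrite intrD /d; lra.
have -> : (fun t => f (t + c)) = (fun t => f (t + d)).
  by apply/funext => t; rewrite -[RHS](periodic_int _ pf (Num.floor c)) /d addrA subrK.
rewrite -intab_shift// add0r (intab_split d (1 + d) 1)//; last by rewrite lerDl.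
have -> : intab 1 (1 + d) f = intab 0 d f.
  have := intab_shift 1 0 d f bf; rewrite add0r (addrC d) => ->.
  by apply: eq_intab => x _; exact: pf.
by rewrite addrC -intab_split.
Qed.

End BoundedMeasurable.

(** * Fubini and moving averages *)

Section Averages.
Local Open Scope classical_set_scope.
Context {R : realType}.
Implicit Types (f g phi : R -> R) (a b c d h : R).
Local Notation mu := (@lebesgue_measure R).

Definition bmeas2 (F : R * R -> R) : Prop :=
  measurable_fun setT F /\ exists M, forall z, `|F z| <= M.

Lemma bmeas2_fst F x : bmeas2 F -> bmeas (fun y => F (x, y)).
Proof. by move=> [mF [M FM]]; split; [exact: measurable_fun_pair2|exists M]. Qed.

Lemma bmeas2_snd F y : bmeas2 F -> bmeas (fun x => F (x, y)).
Proof. by move=> [mF [M FM]]; split; [exact: measurable_fun_pair1|exists M]. Qed.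

Lemma intabE a b f : bmeas f ->
  (intab a b f)%:E = (\int[mu]_(x in `[a, b]) (f x)%:E)%E.
Proof.
move=> bf; rewrite /intab /Rintegral fineK//.
by apply: integrable_fin_num => //; exact: bmeas_integrable.
Qed.

Lemma le_normr_intab_bound a b f M : a <= b -> bmeas f ->
  (forall x, `|f x| <= M) -> `|intab a b f| <= M * (b - a).
Proof.
move=> ab bf fM; rewrite (le_trans (le_normr_intab _ _ _ bf))//.
rewrite -intab_cst//; apply: le_intab => //; last exact: bmeas_cst.
case: bf => mf _; split; first exact: measurableT_comp.
by exists M => x; rewrite normr_id.
Qed.

Lemma measurable_indic_itv a b (f : R * R -> R) :
  measurable_fun setT f -> measurable_fun setT (fun z => \1_(`[a, b]%classic) (f z) : R).
Proof. by move=> mf; apply: (measurableT_comp _ mf); exact: measurable_indic. Qed.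

Lemma bmeas2D F G : bmeas2 F -> bmeas2 G -> bmeas2 (fun z => F z + G z).
Proof.
move=> [mf [M fM]] [mg [M' gM']]; split; first exact: measurable_funD.
by exists (M + M') => x; rewrite (le_trans (ler_normD _ _))// lerD.
Qed.

(** Measurability in the parameter comes from Tonelli, which wants a nonnegative function on the
    whole plane: hence the shift by [M] and the indicator of the inner interval. *)
Lemma bmeas2_intab F c d : c <= d -> bmeas2 F -> bmeas (fun x => intab c d (fun y => F (x, y))).
Proof.
move=> cd bF; have [mF [M FM]] := bF.
split; last first.
  by exists (M * (d - c)) => x; apply: le_normr_intab_bound => //; exact: bmeas2_fst.
have bFM : bmeas2 (fun z => F z + M).
  by apply: bmeas2D => //; split; [exact: measurable_cst|exists `|M|].
have FM0 z : 0 <= F z + M.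
  by rewrite -lerBlDr sub0r; have /lerNnormlW := FM z.
have -> : (fun x => intab c d (fun y => F (x, y))) =
  (fun x => intab c d (fun y => F (x, y) + M) - intab c d (cst M)).
  apply/funext => x; rewrite intabD ?addrK//; first exact: bmeas2_fst.
  exact: bmeas_cst.
apply: measurable_funB => //.
apply/measurable_EFinP.
pose G z := ((F z + M) * \1_(`[c, d]%classic) z.2)%:E.
suff -> : EFin \o (fun x => intab c d (fun y => F (x, y) + M)) = fubini_F mu G.
  apply: measurable_fun_fubini_tonelli_F.
    apply/measurable_EFinP; apply: measurable_funM; first by case: bFM.
    exact: measurable_indic_itv.
  by move=> z; rewrite lee_fin mulr_ge0.
apply/funext => x /=; rewrite intabE; last exact: (bmeas2_fst _ _ bFM).
rewrite integral_mkcond; apply: eq_integral => y _.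
rewrite /G /= indicE patchE; case: ifPn; first by rewrite mulr1.
by rewrite mulr0.
Qed.

Lemma bmeas2_intab_snd F a b : a <= b -> bmeas2 F ->
  bmeas (fun y => intab a b (fun x => F (x, y))).
Proof.
move=> ab [mF [M FM]]; apply: (bmeas2_intab (fun z => F (z.2, z.1))) => //.
split; last by exists M.
by apply: (measurableT_comp mF); exact: measurable_swap.
Qed.

Lemma ge0_intab_exchange F a b c d : a <= b -> c <= d -> bmeas2 F -> (forall z, 0 <= F z) ->
  intab a b (fun x => intab c d (fun y => F (x, y))) =
  intab c d (fun y => intab a b (fun x => F (x, y))).
Proof.
move=> ab cd bF F0; have [mF [M FM]] := bF.
apply: EFin_inj; rewrite !intabE; last 2 first.
- exact: bmeas2_intab_snd.
- exact: (bmeas2_intab F).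
under eq_integral do rewrite (intabE _ _ _ (bmeas2_fst _ _ bF)).
under [RHS]eq_integral do rewrite (intabE _ _ _ (bmeas2_snd _ _ bF)).
pose G z := (F z * \1_(`[a, b]%classic) z.1 * \1_(`[c, d]%classic) z.2)%:E.
transitivity (\int[mu]_x \int[mu]_y G (x, y))%E.
  rewrite integral_mkcond; apply: eq_integral => x _.
  rewrite patchE; case: ifPn => xD.
    rewrite integral_mkcond; apply: eq_integral => y _.
    rewrite /G /= !indicE xD mulr1 patchE; case: ifPn; first by rewrite mulr1.
    by rewrite mulr0.
  rewrite integral0_eq// => y _.
  by rewrite /G /= !indicE (negbTE xD) mulr0 mul0r.
rewrite fubini_tonelli; last 2 first.
- apply/measurable_EFinP; apply: measurable_funM; last exact: measurable_indic_itv.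
  by apply: measurable_funM => //; exact: measurable_indic_itv.
- by move=> z; rewrite lee_fin !mulr_ge0.
rewrite [RHS]integral_mkcond; apply: eq_integral => y _.
rewrite patchE; case: ifPn => yD.
  rewrite [RHS]integral_mkcond; apply: eq_integral => x _.
  rewrite /G /= !indicE yD mulr1 patchE; case: ifPn; first by rewrite mulr1.
  by rewrite mulr0.
rewrite integral0_eq// => x _.
by rewrite /G /= !indicE (negbTE yD) mulr0.
Qed.

(** Tonelli for [F + M]; the constant [M] contributes the same area term to both iterated
    integrals. *)
Lemma intab_exchange F a b c d : a <= b -> c <= d -> bmeas2 F ->
  intab a b (fun x => intab c d (fun y => F (x, y))) =
  intab c d (fun y => intab a b (fun x => F (x, y))).
Proof.
move=> ab cd bF; have [mF [M FM]] := bF.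
have bFM : bmeas2 (fun z => F z + M).
  by apply: bmeas2D => //; split; [exact: measurable_cst|exists `|M|].
have FM0 z : 0 <= F z + M.
  by rewrite -lerBlDr sub0r; have /lerNnormlW := FM z.
have := ge0_intab_exchange _ _ _ _ _ ab cd bFM FM0.
have bM := bmeas_cst M.
have eL : intab a b (fun x => intab c d (fun y => F (x, y) + M)) =
    intab a b (fun x => intab c d (fun y => F (x, y))) + M * (d - c) * (b - a).
  rewrite -(intab_cst _ _ (M * (d - c)) ab) -intabD; last exact: bmeas_cst.
    apply: eq_intab => x _; rewrite intabD//; last exact: bmeas2_fst.
    by rewrite -[X in _ + X]/(intab c d (cst M)) intab_cst.
  exact: bmeas2_intab.
have eR : intab c d (fun y => intab a b (fun x => F (x, y) + M)) =
    intab c d (fun y => intab a b (fun x => F (x, y))) + M * (b - a) * (d - c).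
  rewrite -(intab_cst _ _ (M * (b - a)) cd) -intabD; last exact: bmeas_cst.
    apply: eq_intab => x _; rewrite intabD//; last exact: bmeas2_snd.
    by rewrite -[X in _ + X]/(intab a b (cst M)) intab_cst.
  exact: bmeas2_intab_snd.
by rewrite /= eL eR mulrAC => /addIr.
Qed.

Lemma bmeas2_comp f (G : R * R -> R) : bmeas f -> measurable_fun setT G ->
  bmeas2 (fun z => f (G z)).
Proof.
by move=> [mf [M fM]] mG; split; [exact: (measurableT_comp mf)|exists M].
Qed.

Lemma bmeas2M F G : bmeas2 F -> bmeas2 G -> bmeas2 (fun z => F z * G z).
Proof.
move=> [mf [M fM]] [mg [M' gM']]; split; first exact: measurable_funM.
by exists (M * M') => x; rewrite normrM ler_pM.
Qed.

(** There is no division by [h], so that the derivative of the average is the plain difference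
    [f (x + h) - f x]. *)
Definition avg h f (x : R) : R := intab 0 h (fun t => f (x + t)).

Lemma bmeas_addl x f : bmeas f -> bmeas (fun t => f (x + t)).
Proof.
by move=> /(bmeas_shift x); under eq_fun do rewrite addrC.
Qed.

Lemma bmeas_subl x f : bmeas f -> bmeas (fun t => f (x - t)).
Proof.
move=> [mf [M fM]]; split; last by exists M.
by apply: (measurableT_comp mf); exact: measurable_funB.
Qed.

Lemma bmeas_avg h f : 0 <= h -> bmeas f -> bmeas (avg h f).
Proof.
move=> h0 bf; apply: (bmeas2_intab (fun z => f (z.1 + z.2))) => //.
apply: bmeas2_comp => //; exact: measurable_funD.
Qed.

Lemma periodic_avg h f : periodic f 1 -> periodic (avg h f) 1.
Proof. by move=> pf x; apply: eq_intab => t _; rewrite addrAC pf. Qed.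

Lemma avg_shift h c f x : avg h (fun y => f (y - c)) x = avg h f (x - c).
Proof. by apply: eq_intab => t _; rewrite addrAC. Qed.

Lemma avg_ge0 h f x : (forall y, 0 <= f y) -> 0 <= avg h f x.
Proof. by move=> f0; exact: intab_ge0. Qed.

(** Forward and backward averaging are adjoint over a period: exchange the integrals, then translate
    the inner one by [t] using periodicity. *)
Lemma intab_avgM h f g : 0 <= h -> bmeas f -> bmeas g ->
    periodic f 1 -> periodic g 1 ->
  intab 0 1 (fun x => avg h f x * g x) =
  intab 0 1 (fun x => f x * intab 0 h (fun t => g (x - t))).
Proof.
move=> h0 bf bg pf pg.
transitivity (intab 0 1 (fun x => intab 0 h (fun t => f (x + t) * g x))).
  apply: eq_intab => x _; rewrite mulrC -intabZ; last exact: bmeas_addl.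
  by apply: eq_intab => t _; rewrite mulrC.
rewrite (intab_exchange (fun z => f (z.1 + z.2) * g z.1))//=; last first.
  by apply: bmeas2M; apply: bmeas2_comp => //; exact: measurable_funD.
transitivity (intab 0 h (fun t => intab 0 1 (fun x => f x * g (x - t)))).
  apply: eq_intab => t _.
  rewrite -(intab_periodic (fun x => f x * g (x - t)) t).
  - by apply: eq_intab => x _; rewrite addrK.
  - by apply: bmeasM => //; exact: bmeas_shiftB.
  - by move=> x; rewrite pf addrAC pg.
rewrite -(intab_exchange (fun z => f z.1 * g (z.1 - z.2)))//=.
  by apply: eq_intab => x _; rewrite -intabZ//; exact: bmeas_subl.
by apply: bmeas2M; apply: bmeas2_comp => //; exact: measurable_funB.
Qed.

Lemma intab_avg h f : 0 <= h -> bmeas f -> periodic f 1 ->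
  intab 0 1 (avg h f) = h * intab 0 1 f.
Proof.
move=> h0 bf pf; have := intab_avgM h f (cst 1) h0 bf (bmeas_cst 1) pf (fun=> erefl).
rewrite -intabZ// => e; rewrite -[LHS](_ : intab 0 1 (fun x => avg h f x * cst 1 x) = _).
  rewrite e; apply: eq_intab => x _.
  by rewrite -[intab 0 h _]/(intab 0 h (cst 1)) intab_cst// subr0 mul1r mulrC.
by apply: eq_intab => x _; rewrite mulr1.
Qed.

End Averages.

(** * Smooth periodic functions *)

Section PeriodicSmooth.
Local Open Scope classical_set_scope.
Context {R : realType}.
Implicit Types (f g u v phi rho : R -> R) (a b c h : R) (k n : nat).
Local Notation mu := (@lebesgue_measure R).

Lemma derive1Sn n f : derive1n n.+1 f = derive1n n (derive1 f).
Proof. by rewrite /derive1n iterSr. Qed.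

Lemma is_derive_continuous f x df : is_derive x (1 : R) f df -> {for x, continuous f}.
Proof. by move=> [df1 _]; apply/differentiable_continuous/derivable1_diffP. Qed.

Lemma is_derive_comp_shift c f x df : is_derive (x + c) (1 : R) f df ->
  is_derive x (1 : R) (fun y => f (y + c)) df.
Proof.
move=> df1.
have d1 : is_derive x (1 : R) (fun y : R => y + c) 1.
  by have := is_deriveD (is_derive_id x (1 : R)) (is_derive_cst c x (1 : R)); rewrite addr0.
by have := @is_derive1_comp _ f (fun y => y + c) x _ _ df1 d1; rewrite mulr1.
Qed.

Lemma Cper0E f : Cper 0 f <-> periodic f 1 /\ continuous f.
Proof.
split=> [[pf _ cf]|[pf cf]]; first by split=> //; exact: (cf 0%N).
by split=> // -[|i]//.
Qed.

(** With [Cper_derive1], this lets the closure properties of [Cper k] be proved by induction on [k],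
    from a formula for the first derivative only. *)
Lemma CperS k f g : periodic f 1 -> (forall x, is_derive x (1 : R) f (g x)) ->
  Cper k g -> Cper k.+1 f.
Proof.
move=> pf fg [pg dg cg].
have f'g : derive1 f = g.
  by apply/funext => x; rewrite derive1E; case: (fg x).
split=> //.
- by move=> [|i] ik x; [case: (fg x)|rewrite derive1Sn f'g; exact: dg].
- move=> [|i] ik x; first exact: is_derive_continuous (fg x).
  by rewrite derive1Sn f'g; exact: cg.
Qed.

Lemma Cper_is_derive k f x : Cper k.+1 f -> is_derive x (1 : R) f (derive1 f x).
Proof. by move=> [_ df _]; rewrite derive1E; apply/derivableP; exact: (df 0%N). Qed.

Lemma Cper_derive1 k f : Cper k.+1 f -> Cper k (derive1 f).
Proof.
move=> Cf; have [pf df cf] := Cf; split.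
- move=> x; rewrite !derive1E.
  have := is_derive_comp_shift 1 f x _ (Cper_is_derive _ _ (x + 1) Cf).
  by under eq_fun do rewrite pf; rewrite !derive1E => -[].
- by move=> i ik x; rewrite -derive1Sn; exact: df.
- by move=> i ik x; rewrite -derive1Sn; exact: cf.
Qed.

Lemma CperW k f : Cper k.+1 f -> Cper k f.
Proof.
by move=> [pf df cf]; split=> // i ik; [apply: df|apply: cf]; rewrite ltnW.
Qed.

Lemma Cper_continuous k f : Cper k f -> continuous f.
Proof. by move=> [_ _ cf]; exact: (cf 0%N). Qed.

Lemma Cper_periodic k f : Cper k f -> periodic f 1.
Proof. by case. Qed.

Lemma Cper_cst k c : Cper k (cst c : R -> R).
Proof.
elim: k c => [|k ih] c; first by apply/Cper0E; split=> // x; exact: cst_continuous.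
by apply: (CperS _ _ (cst 0)).
Qed.

Lemma CperD k f g : Cper k f -> Cper k g -> Cper k (fun x => f x + g x).
Proof.
elim: k f g => [|k ih] f g Cf Cg.
  move/Cper0E : Cf Cg => [pf cf] /Cper0E[pg cg]; apply/Cper0E; split.
    by move=> x; rewrite pf pg.
  by move=> x; apply: continuousD; [exact: cf|exact: cg].
apply: (CperS _ _ (fun x => derive1 f x + derive1 g x)).
- by move=> x; rewrite (Cper_periodic _ _ Cf) (Cper_periodic _ _ Cg).
- by move=> x; apply: is_deriveD; [exact: Cper_is_derive Cf|exact: Cper_is_derive Cg].
- by apply: ih; exact: Cper_derive1.
Qed.

Lemma CperM k f g : Cper k f -> Cper k g -> Cper k (fun x => f x * g x).
Proof.
elim: k f g => [|k ih] f g Cf Cg.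
  move/Cper0E : Cf Cg => [pf cf] /Cper0E[pg cg]; apply/Cper0E; split.
    by move=> x; rewrite pf pg.
  by move=> x; apply: continuousM; [exact: cf|exact: cg].
apply: (CperS _ _ (fun x => f x * derive1 g x + derive1 f x * g x)).
- by move=> x; rewrite (Cper_periodic _ _ Cf) (Cper_periodic _ _ Cg).
- move=> x; have := is_deriveM (Cper_is_derive _ _ x Cf) (Cper_is_derive _ _ x Cg).
  by rewrite /GRing.scale/= [g x * _]mulrC.
- by apply: CperD; apply: ih; [exact: CperW|exact: Cper_derive1|exact: Cper_derive1|exact: CperW].
Qed.

Lemma Cper_exp k n f : Cper k f -> Cper k (fun x => f x ^+ n).
Proof.
move=> Cf; elim: n => [|n ih]; first exact: (Cper_cst _ 1).
by under eq_fun do rewrite exprS; exact: CperM.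
Qed.

Lemma Cper_shift k c f : Cper k f -> Cper k (fun x => f (x + c)).
Proof.
elim: k f => [|k ih] f Cf.
  move/Cper0E : Cf => [pf cf]; apply/Cper0E; split.
    by move=> x; rewrite addrAC pf.
  move=> x; apply: continuous_comp; last exact: cf.
  by apply: continuousD => //; exact: cst_continuous.
apply: (CperS _ _ (fun x => derive1 f (x + c))).
- by move=> x; rewrite addrAC (Cper_periodic _ _ Cf).
- by move=> x; apply: is_derive_comp_shift; exact: Cper_is_derive Cf.
- by apply: ih; exact: Cper_derive1.
Qed.

Lemma Cper_bmeas k f : Cper k f -> bmeas f.
Proof.
move=> Cf; have pf := Cper_periodic _ _ Cf; have cf := Cper_continuous _ _ Cf.
split; first exact: continuous_measurable_fun.
have [x _ xM] := EVT_max ler01 (continuous_subspaceT cf : {within `[0, 1], continuous f}).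
have [y _ ym] := EVT_min ler01 (continuous_subspaceT cf : {within `[0, 1], continuous f}).
exists (`|f x| + `|f y|) => z.
have zE : f z = f (z - (Num.floor z)%:~R).
  by rewrite -[RHS](periodic_int _ pf (Num.floor z)) subrK.
have zI : z - (Num.floor z)%:~R \in `[0, 1]%R.
  rewrite in_itv/= subr_ge0 floor_le/=.
  by have := floorD1_gt z; rewrite intrD; lra.
rewrite zE; have := xM _ zI; have := ym _ zI; move: (f (_ - _)) => w yw wx.
have := ler_norm (f x); have := ler_norm (f y).
have := ler_norm (- f y); rewrite normrN; have := normr_ge0 (f x).
by rewrite ler_norml; move=> *; apply/andP; split; lra.
Qed.

Lemma intab_FTC a b f g : a < b -> continuous f ->
  (forall x, is_derive x (1 : R) g (f x)) -> intab a b f = g b - g a.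
Proof.
move=> ab cf gf; apply: EFin_inj.
have cg : continuous g by move=> x; exact: is_derive_continuous (gf x).
rewrite /intab /Rintegral (@continuous_FTC2 _ f g a b) //.
- exact: continuous_subspaceT.
- split; first by move=> x _; case: (gf x).
    exact/cvg_at_right_filter/cg.
  exact/cvg_at_left_filter/cg.
- by move=> x _; rewrite derive1E; case: (gf x).
Qed.

Lemma is_derive_intab a x f : a < x -> bmeas f -> continuous f ->
  is_derive x (1 : R) (fun y => intab a y f) (f x).
Proof.
move=> ax bf cf.
have x1 : x < x + 1 by rewrite ltrDl.
have [d e] := @continuous_FTC1_closed _ f a x (x + 1) x1
  (bmeas_integrable f a (x + 1) bf) ax (cf x).
by split; [exact: d|rewrite -derive1E; exact: e].
Qed.

Lemma is_derive_avg h f x : 0 < h -> bmeas f -> continuous f ->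
  is_derive x (1 : R) (avg h f) (f (x + h) - f x).
Proof.
(* Any base point left of [x] would do: for [y] near [x], hence right of [a], the average is a
   difference of two primitives based at [a]. *)
move=> h0 bf cf; pose a := x - 1.
have ax : a < x by rewrite /a; lra.
apply: (@near_eq_is_derive _ _ _ (fun y => intab a (y + h) f - intab a y f)); last first.
  apply: is_deriveB; last exact: is_derive_intab.
  by apply: (is_derive_comp_shift h (fun z => intab a z f)); apply: is_derive_intab => //; rewrite /a; lra.
have : nbhs x [set y | a < y].
  by apply: open_nbhs_nbhs; split => //; exact: open_gt.
apply: filterS => y /= ay.
rewrite (intab_split a (y + h) y)//; [|exact: ltW|by rewrite lerDl ltW].
rewrite addrAC subrr add0r /avg.
have := intab_shift y 0 h f bf; rewrite add0r (addrC h) => ->.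
by apply: eq_intab => t _; rewrite addrC.
Qed.

Lemma Cper_avg k h f : 0 < h -> Cper k f -> Cper k.+1 (avg h f).
Proof.
move=> h0 Cf; have bf := Cper_bmeas _ _ Cf.
apply: (CperS _ _ (fun x => f (x + h) - f x)).
- exact/periodic_avg/(Cper_periodic _ _ Cf).
- by move=> x; apply: is_derive_avg => //; exact: Cper_continuous Cf.
- under eq_fun do rewrite -mulN1r.
  apply: CperD; first exact: Cper_shift.
  by apply: CperM => //; exact: Cper_cst.
Qed.

Lemma derive1_avg h f : 0 < h -> Cper 0 f ->
  derive1 (avg h f) = (fun x => f (x + h) - f x).
Proof.
move=> h0 Cf; apply/funext => x; rewrite derive1E.
by case: (is_derive_avg h f x h0 (Cper_bmeas _ _ Cf) (Cper_continuous _ _ Cf)).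
Qed.

Lemma intab_derive1_sub h f x : 0 < h -> Cper 1 f ->
  intab 0 h (fun t => derive1 f (x - t)) = f x - f (x - h).
Proof.
move=> h0 Cf; have C0 := Cper_derive1 _ _ Cf.
transitivity (- f (x - h) - - f (x - 0)); last by rewrite subr0 opprK addrC.
apply: (intab_FTC 0 h _ (fun t => - f (x - t))) => //.
- move=> t; apply: continuous_comp; last exact: (Cper_continuous _ _ C0).
  by apply: continuousB => //; exact: cst_continuous.
- move=> t.
  have d1 : is_derive t (1 : R) (fun y : R => x - y) (-1).
    by have := is_deriveB (is_derive_cst x t (1 : R)) (is_derive_id t (1 : R)); rewrite sub0r.
  have := @is_derive1_comp _ f (fun y => x - y) t _ _ (Cper_is_derive _ _ _ Cf) d1.
  by move=> /is_deriveN; rewrite mulrN1 opprK.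
Qed.

End PeriodicSmooth.

(** * A smooth periodic approximate identity *)

Section ApproximateIdentity.
Local Open Scope classical_set_scope.
Context {R : realType}.
Implicit Types (f g u v w phi rho : R -> R) (a b c h x y : R) (k n : nat).

Lemma is_derive_scale_comp c f x df : is_derive (c * x) (1 : R) f df ->
  is_derive x (1 : R) (fun y => f (c * y)) (df * c).
Proof.
move=> df1.
have d1 : is_derive x (1 : R) (fun y : R => c * y) c.
  have := is_deriveM (is_derive_cst c x (1 : R)) (is_derive_id x (1 : R)).
  by rewrite /GRing.scale/= mulr1 mulr0 addr0.
exact: (@is_derive1_comp _ f (fun y => c * y) x _ _ df1 d1).
Qed.

Lemma Cper_cos_sin k :
  Cper k (fun x => cos (2 * pi * x)) /\ Cper k (fun x : R => sin (2 * pi * x)).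
Proof.
have pc : periodic (fun x : R => cos (2 * pi * x)) 1.
  move=> x; rewrite mulrDr mulr1 [X in _ + X](_ : _ = pi *+ 2) ?cosD2pi//.
  by rewrite mulr_natl.
have ps : periodic (fun x : R => sin (2 * pi * x)) 1.
  move=> x; rewrite mulrDr mulr1 [X in _ + X](_ : _ = pi *+ 2) ?sinD2pi//.
  by rewrite mulr_natl.
have dc x : is_derive x (1 : R) (fun x => cos (2 * pi * x)) (- sin (2 * pi * x) * (2 * pi)).
  by apply: (is_derive_scale_comp _ cos); exact: is_derive_cos.
have ds x : is_derive x (1 : R) (fun x => sin (2 * pi * x)) (cos (2 * pi * x) * (2 * pi)).
  by apply: (is_derive_scale_comp _ sin); exact: is_derive_sin.
elim: k => [|k [ihc ihs]].
  split; apply/Cper0E; split => // x.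
    exact: is_derive_continuous (dc x).
  exact: is_derive_continuous (ds x).
split.
  apply: (CperS _ _ _ pc dc).
  under eq_fun do rewrite mulNr -mulrN.
  by apply: CperM => //; exact: Cper_cst.
apply: (CperS _ _ _ ps ds).
by apply: CperM => //; exact: Cper_cst.
Qed.

(** This is the square of [cos (pi * x)]: it peaks at the integers with value [1] and decreases
    strictly from [0] to [1/2], so its normalized powers form a smooth periodic approximate
    identity. *)
Definition cosbump (x : R) : R := 2^-1 * (1 + cos (2 * pi * x)).

Lemma Cper_cosbump k : Cper k cosbump.
Proof.
apply: CperM; first exact: Cper_cst.
by apply: CperD; [exact: Cper_cst|have [] := Cper_cos_sin k].
Qed.

Lemma cosbump_ge0 x : 0 <= cosbump x.
Proof. by rewrite /cosbump; have := cos_geN1 (2 * pi * x); lra. Qed.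

Lemma cosbump_lt x y : `|x| <= 2^-1 -> `|y| <= 2^-1 ->
  (cosbump y < cosbump x) = (`|x| < `|y|).
Proof.
move=> x2 y2; rewrite /cosbump ltr_pM2l// ltrD2l.
have pi0 : 0 < 2 * pi :> R by rewrite mulr_gt0// pi_gt0.
rewrite -(cos_norm (2 * pi * y)) -(cos_norm (2 * pi * x)) (normrM _ x) (normrM _ y).
rewrite (gtr0_norm pi0).
have I (z : R) : `|z| <= 2^-1 -> 2 * pi * `|z| \in `[0, pi]%R.
  move=> z2; rewrite in_itv/= (mulr_ge0 (ltW pi0))//=.
  have := ler_wpM2l (ltW pi0) z2.
  by rewrite (_ : 2 * pi * 2^-1 = pi)//; field.
by rewrite ltr_cos ?I// ltr_pM2l.
Qed.

Lemma cosbump_le x y : `|x| <= 2^-1 -> `|y| <= 2^-1 ->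
  (cosbump y <= cosbump x) = (`|x| <= `|y|).
Proof. by move=> x2 y2; rewrite !leNgt cosbump_lt. Qed.

Lemma cosbump_ltr x y : 0 <= x -> x < y -> y <= 2^-1 -> cosbump y < cosbump x.
Proof.
move=> x0 xy y2; rewrite cosbump_lt ?ger0_norm//; lra.
Qed.

Lemma bmeas_cosbumpX n c : bmeas (fun y => cosbump (y + c) ^+ n).
Proof.
by apply: (bmeas_shift c (fun y => cosbump y ^+ n)); apply: (Cper_bmeas 0); exact/Cper_exp/Cper_cosbump.
Qed.


(** The shift by [1/2] puts the peak in the middle of the integration interval instead of at its
    ends. *)
Definition cosmass n : R := intab 0 1 (fun y => cosbump (y - 2^-1) ^+ n).

(** Only the window of width [d] centred at the peak is kept; there the bump is at least its value
    at distance [d / 2]. *)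
Lemma cosmass_ge n d : 0 < d < 2^-1 -> d * cosbump (d / 2) ^+ n <= cosmass n.
Proof.
move=> /andP[d0 d2]; rewrite /cosmass.
have bk := bmeas_cosbumpX n (- 2^-1).
have k0 x y : 0 <= intab x y (fun y => cosbump (y - 2^-1) ^+ n).
  by apply: intab_ge0 => z; rewrite exprn_ge0// cosbump_ge0.
rewrite (intab_split 0 1 (2^-1 - d / 2))//; [|lra|lra].
rewrite (intab_split _ 1 (2^-1 + d / 2))//; [|lra|lra].
rewrite (le_trans _ (ler_wpDl (k0 _ _) (lexx _)))//.
rewrite (le_trans _ (ler_wpDr (k0 _ _) (lexx _)))//.
have dE : 2^-1 + d / 2 - (2^-1 - d / 2) = d by field.
have -> : d * cosbump (d / 2) ^+ n = cosbump (d / 2) ^+ n * (2^-1 + d / 2 - (2^-1 - d / 2)).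
  by rewrite dE mulrC.
rewrite -intab_cst; last lra.
apply: le_intab => //; first exact: bmeas_cst.
move=> x /andP[x1 x2]; rewrite /cst lerXn2r ?nnegrE ?cosbump_ge0//.
have xd : `|x - 2^-1| <= d / 2 by rewrite ler_norml; apply/andP; split; lra.
rewrite cosbump_le ?(ger0_norm (_ : 0 <= d / 2)) //; lra.
Qed.

Lemma cosmass_gt0 n : 0 < cosmass n.
Proof.
have h : 0 < (4^-1 : R) < 2^-1 by apply/andP; split; lra.
apply: lt_le_trans (cosmass_ge n _ h).
rewrite mulr_gt0//.
rewrite exprn_gt0//; apply: le_lt_trans (cosbump_ge0 2^-1) _.
apply: cosbump_ltr; lra.
Qed.

Definition coskernel n (x : R) : R := cosbump x ^+ n / cosmass n.

Lemma Cper_coskernel n : Cper_infty (coskernel n).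
Proof.
move=> k; apply: CperM; last exact: Cper_cst.
exact/Cper_exp/Cper_cosbump.
Qed.

Lemma coskernel_ge0 n x : 0 <= coskernel n x.
Proof. by rewrite divr_ge0 ?exprn_ge0 ?cosbump_ge0// ltW// cosmass_gt0. Qed.

Lemma intab_coskernel n : intab 0 1 (coskernel n) = 1.
Proof.
have Ck := Cper_coskernel n 0%N.
rewrite -(intab_periodic _ (- 2^-1) (Cper_bmeas _ _ Ck) (Cper_periodic _ _ Ck)).
rewrite /coskernel; under eq_intab do rewrite mulrC.
rewrite intabZ; last exact: bmeas_cosbumpX.
by rewrite mulVf// gt_eqF// cosmass_gt0.
Qed.

(* At distance more than [d] from the peak the bump is at most [cosbump d], while its
   mass is at least [d * cosbump (d / 2) ^+ n]. *)
Lemma coskernel_bound w M d e n : bmeas w -> 0 < d < 2^-1 ->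
  (forall x, `|w x| <= M) ->
  (forall x, `|x - 2^-1| <= d -> `|w x - w 2^-1| <= e) -> 0 <= e ->
  `|intab 0 1 (fun y => w y * coskernel n (y - 2^-1)) - w 2^-1| <=
    e + 2 * M / d * (cosbump d / cosbump (d / 2)) ^+ n.
Proof.
move=> bw d02 wM we e0; have /andP[d0 d2] := d02.
have bk := bmeas_cosbumpX n (- 2^-1).
have k0 y : 0 <= cosbump (y - 2^-1) ^+ n by rewrite exprn_ge0// cosbump_ge0.
have M0 : 0 <= M by exact: le_trans (wM 0).
have m0 := cosmass_gt0 n.
have -> : intab 0 1 (fun y => w y * coskernel n (y - 2^-1)) - w 2^-1 =
    intab 0 1 (fun y => (w y - w 2^-1) * cosbump (y - 2^-1) ^+ n) / cosmass n.
  have -> : (fun y => w y * coskernel n (y - 2^-1)) =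
      (fun y => (cosmass n)^-1 * (w y * cosbump (y - 2^-1) ^+ n)).
    by apply/funext => y; rewrite /coskernel mulrA mulrC.
  rewrite intabZ; last exact: bmeasM.
  have -> : (fun y => (w y - w 2^-1) * cosbump (y - 2^-1) ^+ n) =
      (fun y => w y * cosbump (y - 2^-1) ^+ n - w 2^-1 * cosbump (y - 2^-1) ^+ n).
    by apply/funext => y; rewrite mulrBl.
  rewrite intabB; [|exact: bmeasM|exact: bmeasZ].
  rewrite intabZ// -/(cosmass n); field; exact: lt0r_neq0.
have bw' : bmeas (fun y => w y - w 2^-1) by apply: (bmeasB _ (cst _)) => //; exact: bmeas_cst.
rewrite normrM normfV (gtr0_norm m0) ler_pdivrMr//.
have bwk := bmeasM _ _ bw' bk.
have bnorm : bmeas (fun y => `|(w y - w 2^-1) * cosbump (y - 2^-1) ^+ n|).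
  have [mk [K kK]] := bwk; split; first exact: measurableT_comp.
  by exists K => y; rewrite normr_id.
apply: le_trans (le_normr_intab _ _ _ bwk) _.
(* The first term dominates near the peak and the second away from it. Their sum dominates
   everywhere, which avoids splitting the integral. *)
apply: (@le_trans _ _ (intab 0 1 (fun y => e * cosbump (y - 2^-1) ^+ n + 2 * M * cosbump d ^+ n))).
  apply: le_intab => //.
    by apply: bmeasD; [exact: bmeasZ|exact: bmeas_cst].
  move=> y /andP[y0 y1]; rewrite normrM (ger0_norm (k0 y)).
  have cd0 : 0 <= cosbump d ^+ n by rewrite exprn_ge0// cosbump_ge0.
  have [yd|yd] := leP `|y - 2^-1| d.
    apply: (@le_trans _ _ (e * cosbump (y - 2^-1) ^+ n)).
      by rewrite ler_wpM2r// we.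
    by rewrite lerDl !mulr_ge0.
  apply: (@le_trans _ _ (2 * M * cosbump d ^+ n)); last by rewrite lerDr mulr_ge0.
  apply: ler_pM => //.
    rewrite (le_trans (ler_normB _ _))//; have := wM y; have := wM 2^-1; lra.
  have y2 : `|y - 2^-1| <= 2^-1 by rewrite ler_norml; apply/andP; split; lra.
  rewrite lerXn2r ?nnegrE ?cosbump_ge0// cosbump_le ?(gtr0_norm d0)//; exact: ltW.
rewrite intabD; [|exact: bmeasZ|exact: bmeas_cst].
rewrite intabZ// intab_cst// subr0 mulr1 -/(cosmass n) [leRHS]mulrDl lerD2l.
have b0 : 0 < cosbump (d / 2).
  apply: le_lt_trans (cosbump_ge0 d) _; apply: cosbump_ltr; lra.
(* Multiplied by [2 * M / d] and the ratio of the two powers, the mass bound has left side exactly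
   [2 * M * cosbump d ^+ n]. *)
have := cosmass_ge n d d02.
rewrite expr_div_n => /(ler_wpM2l (_ : 0 <= 2 * M / d * (cosbump d ^+ n / cosbump (d / 2) ^+ n))).
move=> h; apply: le_trans (h _); last first.
  by rewrite mulr_ge0// ?divr_ge0 ?mulr_ge0 ?exprn_ge0 ?cosbump_ge0// ltW.
rewrite le_eqVlt; apply/orP; left; apply/eqP; field.
by rewrite expf_neq0 ?gt_eqF.
Qed.

(** After translating [x] to the peak [1/2], continuity accounts for half of the error and the
    geometric decay of [q ^+ n] for the other half. *)
Lemma coskernel_cvg v x : Cper 0 v ->
  (fun n => intab 0 1 (fun y => v y * coskernel n (y - x))) @ \oo --> v x.
Proof.
move=> Cv; have bv := Cper_bmeas _ _ Cv; have pv := Cper_periodic _ _ Cv.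
have cv := Cper_continuous _ _ Cv.
pose w y := v (y + (x - 2^-1)).
have Cw : Cper 0 w by exact: Cper_shift.
have [_ [M wM]] := Cper_bmeas _ _ Cw.
have wE : w 2^-1 = v x by rewrite /w addrC subrK.
have iE n : intab 0 1 (fun y => v y * coskernel n (y - x)) =
    intab 0 1 (fun y => w y * coskernel n (y - 2^-1)).
  have Ck := Cper_coskernel n 0%N.
  have bk := Cper_bmeas _ _ Ck; have pk := Cper_periodic _ _ Ck.
  rewrite -(intab_periodic (fun y => v y * coskernel n (y - x)) (x - 2^-1)).
  - by apply: eq_intab => y _; rewrite /w; congr (_ * coskernel n _); ring.
  - by apply: bmeasM => //; exact: bmeas_shiftB.
  - by move=> y; rewrite pv addrAC pk.
under eq_fun do rewrite iE.
rewrite -wE; apply/cvgrPdist_le => e e0.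
have e20 : 0 < e / 2 by rewrite divr_gt0.
have /cvgrPdist_le/(_ _ e20) := Cper_continuous _ _ Cw 2^-1.
move=> /nbhs_ballP[d0 /= d00 wd].
pose d := Num.min (d0 / 2) 4^-1.
have d0p : 0 < d by rewrite lt_min divr_gt0//=; lra.
have dd0 : d < d0 by rewrite gt_min; apply/orP; left; lra.
have d2 : d < 2^-1 by rewrite gt_min; apply/orP; right; lra.
have we z : `|z - 2^-1| <= d -> `|w z - w 2^-1| <= e / 2.
  move=> zd; rewrite distrC; apply: wd; rewrite /ball/= distrC.
  exact: le_lt_trans zd dd0.
pose q := cosbump d / cosbump (d / 2).
have b0 : 0 < cosbump (d / 2).
  apply: le_lt_trans (cosbump_ge0 d) _; apply: cosbump_ltr; lra.
have q1 : `|q| < 1.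
  rewrite ger0_norm ?divr_ge0 ?cosbump_ge0// ltr_pdivrMr// mul1r.
  by apply: cosbump_ltr; lra.
have : (fun n => 2 * M / d * q ^+ n) @ \oo --> (0 : R).
  by rewrite -(mulr0 (2 * M / d)); apply: cvgM; [exact: cvg_cst|exact: cvg_expr].
move=> /cvgrPdist_le/(_ _ e20); apply: filterS => n; rewrite sub0r normrN => qn.
rewrite distrC; have d02 : 0 < d < 2^-1 by rewrite d0p.
apply: le_trans (coskernel_bound w M d _ n (Cper_bmeas _ _ Cw) d02 wM we (ltW e20)) _.
rewrite -/q; have := ler_norm (2 * M / d * q ^+ n); lra.
Qed.

End ApproximateIdentity.

(** * Integration over the unit interval *)

Section UnitMeasure.
Local Open Scope classical_set_scope.
Context {R : realType}.
Implicit Types (f g psi : R -> R).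
Local Notation mu := (@lebesgue_measure R).
Local Notation unit := (@unit_measure R).

Lemma unit_measureE (A : set R) : unit A = mu (A `&` `[0, 1]).
Proof. by []. Qed.

Lemma unit_measureT : unit setT = 1%E.
Proof. by rewrite unit_measureE setTI /= lebesgue_measure_itv/= lte01 oppr0 adde0. Qed.

(** The complement of the unit interval is null for [unit_measure], and on the interval the two
    measures agree. *)
Lemma ge0_integral_unit (f : R -> \bar R) : measurable_fun setT f ->
  (forall x, (0 <= f x)%E) ->
  (\int[unit]_x f x = \int[mu]_(x in `[0%R, 1%R]) f x)%E.
Proof.
move=> mf f0.
have mI : measurable (`[0, 1]%classic : set R) by exact: measurable_itv.
rewrite -(setUv (`[0, 1]%classic : set R)) ge0_integral_setU//=; last 3 first.
- exact: measurableC.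
- by rewrite setUv.
- exact/disj_setPCl.
rewrite [X in (_ + X)%E](_ : _ = 0%E) ?adde0; last first.
  apply: null_set_integral => //; [exact: measurableC|exact: measurable_funS mf|].
  by rewrite unit_measureE setICl measure0.
apply: eq_measure_integral => A mA AI.
by rewrite unit_measureE setIidl.
Qed.

Lemma integrable_unit f : unit.-integrable setT (EFin \o f) ->
  mu.-integrable `[0, 1] (EFin \o f).
Proof.
move=> /integrableP[mf foo]; apply/integrableP; split; first exact: measurable_funS mf.
by rewrite -ge0_integral_unit//; exact: measurableT_comp.
Qed.

Lemma bmeas_Lfun f : bmeas f -> f \in Lfun unit 1%:E.
Proof.
move=> [mf [M fM]]; apply/Lfun1_integrable.
apply: measurable_bounded_integrable => //; first by rewrite unit_measureT ltry.
exists M; split; first exact: num_real.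
by move=> x Mx y _ /=; rewrite (le_trans (fM y))// ltW.
Qed.

Lemma Lfun_measurable f p : f \in Lfun unit p -> measurable_fun setT f.
Proof. by rewrite inE => /andP[/[!inE]]. Qed.

Lemma integrable_bmeasM f psi : bmeas psi -> mu.-integrable `[0, 1] (EFin \o f) ->
  mu.-integrable `[0, 1] (EFin \o (fun x => f x * psi x)).
Proof.
move=> [mp [M pM]] intf.
apply: (integrableMl _ intf) => //; first exact: measurable_funS mp.
exists M; split; first exact: num_real.
by move=> x Mx y _ /=; rewrite (le_trans (pM y))// ltW.
Qed.

Lemma ae_unit_itv (P : R -> Prop) : {ae unit, forall x, P x} ->
  {ae mu, forall x, `[0, 1]%classic x -> P x}.
Proof.
move=> [A [mA A0 AP]]; exists (A `&` `[0, 1]); split.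
- exact: measurableI.
- exact: A0.
- move=> x /= /not_implyP[xI nP]; split => //; exact: AP.
Qed.

(** Hölder with exponents infinity and 1. As [g] is bounded only almost everywhere, the comparison
    is made on extended-real integrals. *)
Lemma norm_intabM_le g psi M : 0 <= M -> unit.-integrable setT (EFin \o g) -> bmeas psi ->
  (forall x, 0 <= psi x) -> {ae unit, forall x, `|g x| <= M} ->
  `|intab 0 1 (fun x => g x * psi x)| <= M * intab 0 1 psi.
Proof.
move=> M0 ig bp p0 gM.
have ig1 := integrable_unit _ ig.
have igp := integrable_bmeasM _ _ bp ig1.
rewrite -intabZ//.
apply: le_trans (le_normr_Rintegral _ igp) _; first exact: measurable_itv.
rewrite -lee_fin (intabE 0 1 (fun x => M * psi x)); last exact: bmeasZ.
rewrite /Rintegral fineK; last first.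
  apply: integrable_fin_num => //.
  exact: integrable_norm igp.
have mI : measurable (`[0, 1]%classic : set R) by exact: measurable_itv.
apply: ae_ge0_le_integral => //.
- apply/measurable_EFinP; apply: measurableT_comp => //.
  by apply/measurable_EFinP; exact: measurable_int igp.
- by move=> x _; rewrite lee_fin mulr_ge0.
- by apply/measurable_EFinP; apply: measurable_funM => //; apply: measurable_funS (bp.1).
- have [A [mA A0 AP]] := ae_unit_itv _ gM; exists A; split => // x /= nP.
  apply: AP => /= gx; apply: nP => xI.
  by rewrite lee_fin normrM (ger0_norm (p0 x)) ler_wpM2r// gx.
Qed.

(** Cauchy-Schwarz for the weight [psi], by completing a square so that an upper bound [K] on the
    mass suffices. *)
Lemma sq_intabM_le g psi K : mu.-integrable `[0, 1] (EFin \o g) ->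
  mu.-integrable `[0, 1] (EFin \o (fun x => g x ^+ 2)) -> bmeas psi ->
  (forall x, 0 <= psi x) -> 0 < K -> intab 0 1 psi <= K ->
  (intab 0 1 (fun x => g x * psi x)) ^+ 2 <= K * intab 0 1 (fun x => g x ^+ 2 * psi x).
Proof.
move=> ig ig2 bp p0 K0 pK.
have igp := integrable_bmeasM _ _ bp ig.
have ig2p := integrable_bmeasM _ _ bp ig2.
have ip := bmeas_integrable _ 0 1 bp.
set X := intab 0 1 (fun x => g x * psi x).
set Y := intab 0 1 (fun x => g x ^+ 2 * psi x).
(* Integrate [(g - t) ^ 2 * psi >= 0] at the optimal [t]. *)
pose t := X / K.
have mI : measurable (`[0, 1]%classic : set R) by exact: measurable_itv.
have h : 0 <= intab 0 1 (fun x => g x ^+ 2 * psi x - (2 * t * (g x * psi x) - t ^+ 2 * psi x)).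
  apply: intab_ge0 => x.
  rewrite (_ : _ - _ = (g x - t) ^+ 2 * psi x); last by ring.
  by rewrite mulr_ge0// sqr_ge0.
move: h.
have iZ c (F : R -> R) : mu.-integrable `[0, 1] (EFin \o F) ->
    mu.-integrable `[0, 1] (EFin \o (fun x => c * F x)).
  move=> iF; under [X in integrable _ _ X]eq_fun do rewrite /= EFinM.
  exact: integrableZl.
rewrite /intab RintegralB//; last first.
  under [X in integrable _ _ X]eq_fun do rewrite /= EFinB.
  by apply: integrableB => //; exact: iZ.
rewrite RintegralB//; [|exact: iZ|exact: iZ].
rewrite !RintegralZl// -/(intab _ _ _) -/X -/Y => h.
have : t ^+ 2 * intab 0 1 psi <= t ^+ 2 * K by rewrite ler_wpM2l// sqr_ge0.
rewrite /intab => h2.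
have tK : t * K = X by rewrite /t divfK// gt_eqF.
have : 0 <= K * (Y - (2 * t * X - t ^+ 2 * K)).
  rewrite mulr_ge0//; first exact: ltW.
  move: h h2; rewrite /X /Y /intab; lra.
rewrite -tK; lra.
Qed.

End UnitMeasure.

(** * Sup and L^2 norms on the unit interval *)

Section LebesgueNorms.
Local Open Scope classical_set_scope.
Context {R : realType}.
Implicit Types (f g w : R -> R) (M : R).
Local Notation mu := (@lebesgue_measure R).
Local Notation unit := (@unit_measure R).

Lemma Lpnorm_infty_le w M : (forall x, `|w x| <= M) -> (Lpnorm +oo w <= M%:E)%E.
Proof.
move=> wM; rewrite /Lpnorm unlock unit_measureT lte01.
by apply/ess_supP; apply: nearW => x /=; rewrite lee_fin.
Qed.

(** An infinite norm on the right makes the final estimate trivial; otherwise the norm is a real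
    number that bounds [g] almost everywhere. [Lpnorm2_cases] plays the same role for L^2. *)
Lemma Lpnorm_infty_cases g : Lpnorm +oo g = +oo%E \/
  exists M, [/\ 0 <= M, Lpnorm +oo g = M%:E & {ae unit, forall x, `|g x| <= M}].
Proof.
have := Lnorm_ge0 unit +oo (EFin \o g).
rewrite -/(Lpnorm +oo g); case E : (Lpnorm +oo g) => [M| |] // M0; last by left.
right; exists M; split => //.
have := @ess_sup_ge _ _ _ unit (abse \o (EFin \o g)).
move: E; rewrite /Lpnorm unlock unit_measureT lte01 => ->.
by move=> [A [mA A0 AP]]; exists A; split => // x /= nP; apply: AP => /=; rewrite lee_fin.
Qed.

Lemma Lpnorm2E f : measurable_fun setT f ->
  Lpnorm 2%:E f = sqrte (\int[mu]_(x in `[0%R, 1%R]) (f x ^+ 2)%:E)%E.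
Proof.
move=> mf; rewrite /Lpnorm unlock.
have e (x : R) : (`|(EFin \o f) x| `^ 2 = (f x ^+ 2)%:E)%E.
  by rewrite /= powR_mulrn// real_normK// num_real.
under eq_integral do rewrite e.
rewrite ge0_integral_unit.
- by rewrite poweR12_sqrt// integral_ge0// => x _; rewrite lee_fin sqr_ge0.
- by apply/measurable_EFinP; exact: measurable_funX.
- by move=> x; rewrite lee_fin sqr_ge0.
Qed.

Lemma Lpnorm2_bmeas w : bmeas w ->
  Lpnorm 2%:E w = (Num.sqrt (intab 0 1 (fun x => w x ^+ 2)))%:E.
Proof.
move=> bw; rewrite Lpnorm2E; last exact: bw.1.
by rewrite -(intabE 0 1 (fun x => w x ^+ 2))//; exact: bmeasM.
Qed.

Lemma Lpnorm2_cases g : measurable_fun setT g -> Lpnorm 2%:E g = +oo%E \/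
  mu.-integrable `[0, 1] (EFin \o (fun x => g x ^+ 2)) /\
  Lpnorm 2%:E g = (Num.sqrt (intab 0 1 (fun x => g x ^+ 2)))%:E.
Proof.
move=> mg; rewrite Lpnorm2E//.
have [oo|noo] := eqVneq (\int[mu]_(x in `[0%R, 1%R]) (g x ^+ 2)%:E)%E +oo%E.
  by left; rewrite oo.
have ig : mu.-integrable `[0, 1] (EFin \o (fun x => g x ^+ 2)).
  apply/integrableP; split.
    by apply/measurable_EFinP; apply: measurable_funX; exact: measurable_funS mg.
  rewrite ltey; apply: contra_neq noo => <-; apply: eq_integral => x _ /=.
  by rewrite ger0_norm// sqr_ge0.
right; split => //; rewrite /intab /Rintegral.
have : (\int[mu]_(x in `[0%R, 1%R]) (g x ^+ 2)%:E)%E \is a fin_num.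
  exact: integrable_fin_num ig.
by case: (integral _ _ _).
Qed.

End LebesgueNorms.

(** * Weak derivatives *)

Section WeakDerivatives.
Local Open Scope classical_set_scope.
Context {R : realType}.
Implicit Types (f g u v w phi rho : R -> R) (c h x : R) (l k : nat).
Local Notation mu := (@lebesgue_measure R).
Local Notation unit := (@unit_measure R).

Definition fdiff h f (x : R) : R := f (x + h) - f x.
Definition bdiff h f (x : R) : R := f x - f (x - h).

Lemma avg_fdiff h f : bmeas f -> avg h (fdiff h f) = fdiff h (avg h f).
Proof.
move=> bf; apply/funext => x; rewrite /avg /fdiff intabB.
- by congr (_ - _); apply: eq_intab => t _; rewrite addrAC.
- by have := bmeas_addl x _ (bmeas_shift h _ bf).
- exact: bmeas_addl.
Qed.

Lemma bmeas_fdiff h f : bmeas f -> bmeas (fdiff h f).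
Proof. by move=> bf; apply: bmeasB => //; exact: bmeas_shift. Qed.

Lemma bmeas_bdiff h f : bmeas f -> bmeas (bdiff h f).
Proof. by move=> bf; apply: bmeasB => //; exact: bmeas_shiftB. Qed.

Lemma periodic_fdiff h f : periodic f 1 -> periodic (fdiff h f) 1.
Proof. by move=> pf x; rewrite /fdiff addrAC !pf. Qed.

Lemma periodic_bdiff h f : periodic f 1 -> periodic (bdiff h f) 1.
Proof. by move=> pf x; rewrite /bdiff addrAC !pf. Qed.

Lemma Cper_fdiff k h f : Cper k f -> Cper k (fdiff h f).
Proof.
move=> Cf; rewrite /fdiff; under eq_fun do rewrite -mulN1r.
apply: CperD; first exact: Cper_shift.
by apply: CperM => //; exact: Cper_cst.
Qed.

Lemma Cper_bdiff k h f : Cper k f -> Cper k (bdiff h f).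
Proof.
move=> Cf; rewrite /bdiff; under eq_fun do rewrite -mulN1r.
apply: CperD => //; apply: CperM; first exact: Cper_cst.
exact: Cper_shift.
Qed.

Lemma Cper_iter_bdiff k l h f : Cper k f -> Cper k (iter l (bdiff h) f).
Proof. by move=> Cf; elim: l => [//|l ih] /=; exact: Cper_bdiff. Qed.

Lemma Cper_infty_iter_avg l h f : 0 < h -> Cper_infty f -> Cper_infty (iter l (avg h) f).
Proof.
by move=> h0 Cf; elim: l => [//|l ih] k /=; apply: CperW; apply: Cper_avg.
Qed.

Lemma iter_avg_fdiff l h f : 0 < h -> Cper_infty f ->
  iter l (avg h) (fdiff h f) = fdiff h (iter l (avg h) f).
Proof.
move=> h0 Cf; elim: l => [//|l ih] /=; rewrite ih avg_fdiff//.
exact: Cper_bmeas (Cper_infty_iter_avg l h f h0 Cf 0%N).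
Qed.

(** Each derivative cancels one average and leaves a forward difference, which commutes with the
    remaining averages. *)
Lemma derive1n_iter_avg l h f : 0 < h -> Cper_infty f ->
  derive1n l (iter l (avg h) f) = iter l (fdiff h) f.
Proof.
move=> h0; elim: l f => [//|l ih] f Cf.
rewrite derive1Sn iterS derive1_avg//; last exact: Cper_infty_iter_avg.
rewrite -[X in derive1n _ X]/(fdiff h (iter l (avg h) f)) -iter_avg_fdiff// ih.
  by rewrite -iterSr.
by move=> k; exact: Cper_fdiff.
Qed.

(** Summation by parts: periodicity moves the translation by [h] from [f] to [u], with no boundary
    term. *)
Lemma intab_fdiff h u f : bmeas u -> bmeas f -> periodic u 1 -> periodic f 1 ->
  intab 0 1 (fun x => u x * fdiff h f x) = - intab 0 1 (fun x => bdiff h u x * f x).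
Proof.
move=> bu bf pu pf.
have bfh := bmeas_shift h _ bf; have buh := bmeas_shiftB h _ bu.
rewrite /fdiff /bdiff; under eq_fun do rewrite mulrBr.
under [X in - intab _ _ X]eq_fun do rewrite mulrBl.
rewrite !intabB; try exact: bmeasM.
rewrite opprB; congr (_ - _).
rewrite -(intab_periodic (fun x => u (x - h) * f x) h).
- by apply: eq_intab => x _; rewrite addrK.
- exact: bmeasM.
- by move=> x; rewrite pf addrAC pu.
Qed.

Lemma intab_iter_fdiff l h u f : bmeas u -> bmeas f -> periodic u 1 -> periodic f 1 ->
  intab 0 1 (fun x => u x * iter l (fdiff h) f x) =
  (-1) ^+ l * intab 0 1 (fun x => iter l (bdiff h) u x * f x).
Proof.
elim: l u f => [|l ih] u f bu bf pu pf; first by rewrite mul1r.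
rewrite iterSr ih//; [|exact: bmeas_fdiff|exact: periodic_fdiff].
rewrite intab_fdiff//; last 2 first.
- by elim: (l) => [//|k bk] /=; exact: bmeas_bdiff.
- by elim: (l) => [//|k pk] /=; exact: periodic_bdiff.
by rewrite mulrN exprS mulN1r mulNr.
Qed.

(** The [l]-fold average of [rho] is an admissible test function whose [l]-th derivative is the
    [l]-fold forward difference of [rho]. The sign from summation by parts cancels the one in the
    weak derivative. *)
Lemma weak_deriv_iter_bdiff l h u g rho : 0 < h -> Cper 0 u -> is_weak_deriv l u g ->
  Cper_infty rho ->
  intab 0 1 (fun x => iter l (bdiff h) u x * rho x) =
  intab 0 1 (fun x => g x * iter l (avg h) rho x).
Proof.
move=> h0 Cu [_ _ /(_ _ (Cper_infty_iter_avg l h rho h0 _))ug] Crho.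
have := ug Crho; rewrite derive1n_iter_avg//.
rewrite -[LHS]/(intab 0 1 (fun x => u x * iter l (fdiff h) rho x)).
rewrite intab_iter_fdiff; last 4 first.
- exact: Cper_bmeas Cu.
- exact: Cper_bmeas (Crho 0%N).
- exact: Cper_periodic Cu.
- exact: Cper_periodic (Crho 0%N).
by move=> /mulfI; apply; rewrite expf_neq0// oppr_eq0 oner_eq0.
Qed.

Lemma weak_deriv0 f : bmeas f -> periodic f 1 -> is_weak_deriv 0 f f.
Proof.
by move=> bf pf; split => //; [exact: bmeas_Lfun|move=> phi _; rewrite mul1r].
Qed.

(** Here [f] may jump, as the B-spline of order 1 does. The average is therefore moved onto the
    derivative of the test function, where it integrates to a classical difference, and summation by
    parts brings that difference back to [f]. *)
Lemma weak_deriv_avg h f : 0 < h -> bmeas f -> periodic f 1 ->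
  is_weak_deriv 1 (avg h f) (fdiff h f).
Proof.
move=> h0 bf pf; split; first exact: periodic_fdiff.
  exact/bmeas_Lfun/bmeas_fdiff.
move=> phi Cphi; rewrite expr1 mulN1r.
have bphi := Cper_bmeas _ _ (Cphi 0%N); have pphi := Cper_periodic _ _ (Cphi 0%N).
have C1 := Cper_derive1 _ _ (Cphi 1%N).
rewrite -[LHS]/(intab 0 1 (fun x => avg h f x * derive1 phi x)).
rewrite intab_avgM//; [|exact: ltW|exact: Cper_bmeas C1|exact: Cper_periodic C1].
rewrite -[X in - X]/(intab 0 1 (fun x => fdiff h f x * phi x)).
have -> : (fun x => fdiff h f x * phi x) = (fun x => phi x * fdiff h f x).
  by apply/funext => x; rewrite mulrC.
rewrite intab_fdiff// opprK; apply: eq_intab => x _.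
by rewrite intab_derive1_sub// mulrC.
Qed.

Lemma weak_deriv_comp l u v w : is_weak_deriv l u v -> is_weak_deriv 1 v w ->
  is_weak_deriv l.+1 u w.
Proof.
move=> [_ _ uv] [pw iw vw]; split => // phi Cphi.
have C1 : Cper_infty (derive1 phi) by move=> k; apply: Cper_derive1.
have := uv _ C1; have := vw _ Cphi.
by rewrite (derive1Sn l) derive1n1 expr1 mulN1r => -> ->; rewrite mulrN exprS mulN1r mulNr.
Qed.

Lemma Cper_infty_derive1n l phi : Cper_infty phi -> Cper_infty (derive1n l phi).
Proof.
elim: l phi => [//|l ih] phi Cphi; rewrite derive1Sn; apply: ih => k.
exact: Cper_derive1.
Qed.

Lemma weak_deriv_bmeasP l u v : periodic v 1 -> bmeas v ->
  is_weak_deriv l u v <-> forall phi, Cper_infty phi ->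
    intab 0 1 (fun x => u x * derive1n l phi x) =
    (-1) ^+ l * intab 0 1 (fun x => v x * phi x).
Proof.
move=> pv bv; split=> [[_ _ uv]//|uv]; split => //; exact: bmeas_Lfun.
Qed.

Lemma weak_derivZ l c u v : bmeas u -> bmeas v -> is_weak_deriv l u v ->
  is_weak_deriv l (fun x => c * u x) (fun x => c * v x).
Proof.
move=> bu bv uv; have [pv _ _] := uv.
apply/weak_deriv_bmeasP; [by move=> x; rewrite pv|exact: bmeasZ|move=> phi Cphi].
have bphi := Cper_bmeas _ _ (Cphi 0%N).
have bphil := Cper_bmeas _ _ (Cper_infty_derive1n l _ Cphi 0%N).
under eq_fun do rewrite -mulrA; under [in RHS]eq_fun do rewrite -mulrA.
rewrite !intabZ; [|exact: bmeasM..].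
by rewrite mulrCA (proj1 (weak_deriv_bmeasP _ _ _ pv bv) uv).
Qed.

Lemma weak_deriv_sum (I : Type) (s : seq I) l (u v : I -> R -> R) :
  (forall i, bmeas (u i)) -> (forall i, bmeas (v i)) ->
  (forall i, is_weak_deriv l (u i) (v i)) ->
  is_weak_deriv l (fun x => \sum_(i <- s) u i x) (fun x => \sum_(i <- s) v i x).
Proof.
move=> bu bv uv; have pv i : periodic (v i) 1 by have [] := uv i.
apply/weak_deriv_bmeasP.
- by move=> x; apply: eq_bigr => i _; rewrite pv.
- exact: bmeas_sum.
- move=> phi Cphi.
  have bphi := Cper_bmeas _ _ (Cphi 0%N).
  have bphil := Cper_bmeas _ _ (Cper_infty_derive1n l _ Cphi 0%N).
  under eq_fun do rewrite mulr_suml; under [in RHS]eq_fun do rewrite mulr_suml.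
  rewrite !(intab_sum _ s)//; [|by move=> i; exact: bmeasM..].
  rewrite mulr_sumr; apply: eq_bigr => i _.
  exact: (proj1 (weak_deriv_bmeasP _ _ _ (pv i) (bv i)) (uv i)).
Qed.

End WeakDerivatives.

(** * Bounds on the difference quotients of the data *)

Section DifferenceQuotients.
Local Open Scope classical_set_scope.
Context {R : realType}.
Implicit Types (f g u v w phi rho : R -> R) (c h x : R) (l k : nat).
Local Notation mu := (@lebesgue_measure R).
Local Notation unit := (@unit_measure R).

Lemma intab_sum_split k h f : 0 <= h -> bmeas f ->
  intab (- (k%:R * h)) 0 f = \sum_(1 <= m < k.+1) intab 0 h (fun t => f (t - m%:R * h)).
Proof.
move=> h0 bf; elim: k => [|k ih].
  rewrite big_nil mul0r oppr0 /intab.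
  by rewrite set_itv1 Rintegral_set1.
rewrite big_nat_recr//= -ih (intab_split _ 0 (- (k%:R * h)))//; last 2 first.
- by rewrite lerN2 ler_wpM2r// ler_nat.
- by rewrite oppr_le0 mulr_ge0.
rewrite addrC; congr (_ + _).
rewrite -(intab_shift (- (k.+1%:R * h)))// add0r; congr intab.
by rewrite -natr1 mulrDl mul1r; ring.
Qed.

(** The [N] averaging intervals of length [1/N] are adjacent and tile one full period. *)
Lemma sum_avg_shift N rho x : (0 < N)%N -> bmeas rho -> periodic rho 1 ->
  \sum_(1 <= m < N.+1) avg N%:R^-1 rho (x - m%:R * N%:R^-1) = intab 0 1 rho.
Proof.
move=> N0 br pr; have h0 : 0 <= (N%:R^-1 : R) by rewrite invr_ge0.
have := intab_sum_split N N%:R^-1 (fun t => rho (x + t)) h0 (bmeas_addl x _ br).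
rewrite mulfV ?pnatr_eq0 -?lt0n// => e.
transitivity (intab (-1) 0 (fun t => rho (x + t))).
  rewrite e; apply: eq_bigr => m _; apply: eq_intab => t _; congr rho; ring.
have := intab_shift (-1) 0 1 _ (bmeas_addl x _ br).
rewrite add0r subrr => ->.
rewrite -(intab_periodic rho (x - 1) br pr).
by apply: eq_intab => t _; congr rho; ring.
Qed.

Lemma iter_avg_shift l h c f x :
  iter l (avg h) (fun y => f (y - c)) x = iter l (avg h) f (x - c).
Proof.
elim: l x => [//|l ih] x /=; rewrite -avg_shift.
by congr avg; apply/funext => y; rewrite ih.
Qed.

Lemma bmeas_iter_avg l h f : 0 <= h -> bmeas f -> bmeas (iter l (avg h) f).
Proof. by move=> h0 bf; elim: l => [//|l ih] /=; exact: bmeas_avg. Qed.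

Lemma periodic_iter_avg l h f : periodic f 1 -> periodic (iter l (avg h) f) 1.
Proof. by move=> pf; elim: l => [//|l ih] /=; exact: periodic_avg. Qed.

Lemma iter_avg_ge0 l h f x : (forall y, 0 <= f y) -> 0 <= iter l (avg h) f x.
Proof. by move=> f0; elim: l x => [//|l ih] x /=; exact: avg_ge0. Qed.

Lemma intab_iter_avg l h f : 0 <= h -> bmeas f -> periodic f 1 ->
  intab 0 1 (iter l (avg h) f) = h ^+ l * intab 0 1 f.
Proof.
move=> h0 bf pf; elim: l => [|l ih] /=; first by rewrite mul1r.
rewrite intab_avg//; [|exact: bmeas_iter_avg|exact: periodic_iter_avg].
by rewrite ih exprS mulrA.
Qed.

Lemma Rintegral_sumM (I : Type) (s : seq I) (psi : I -> R -> R) f :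
  (forall i, bmeas (psi i)) -> mu.-integrable `[0, 1] (EFin \o f) ->
  \sum_(i <- s) intab 0 1 (fun x => f x * psi i x) =
  intab 0 1 (fun x => f x * \sum_(i <- s) psi i x).
Proof.
move=> bp intf; elim: s => [|i s ih].
  rewrite big_nil; under eq_intab do rewrite big_nil mulr0.
  by rewrite -[RHS]/(intab 0 1 (cst 0)) intab_cst// mul0r.
rewrite big_cons ih; under [RHS]eq_intab do rewrite big_cons mulrDr.
rewrite /intab RintegralD//; first exact: integrable_bmeasM.
by apply: integrable_bmeasM => //; exact: bmeas_sum.
Qed.

Let rho_ n x (y : R) := coskernel n (y - x).

Let Crho n x : Cper_infty (rho_ n x).
Proof. by move=> k; apply: Cper_shift; exact: Cper_coskernel. Qed.

Let intab_rho n x : intab 0 1 (rho_ n x) = 1.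
Proof.
have C := @Cper_coskernel R n 0%N; apply: (etrans _ (intab_coskernel n)).
exact: (intab_periodic _ (- x) (Cper_bmeas _ _ C) (Cper_periodic _ _ C)).
Qed.

Let intab_iter_rho l h n x : 0 <= h -> intab 0 1 (iter l (avg h) (rho_ n x)) = h ^+ l.
Proof.
move=> h0; rewrite intab_iter_avg//; first by rewrite intab_rho mulr1.
  exact: Cper_bmeas (Crho n x 0%N).
exact: Cper_periodic (Crho n x 0%N).
Qed.

Let bmeas_iter_rho l h n x : 0 <= h -> bmeas (iter l (avg h) (rho_ n x)).
Proof. move=> h0; apply: bmeas_iter_avg => //; exact: Cper_bmeas (Crho n x 0%N). Qed.

Let iter_rho_ge0 l h n x y : 0 <= iter l (avg h) (rho_ n x) y.
Proof. by apply: iter_avg_ge0 => z; exact: coskernel_ge0. Qed.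

(** The difference of [u] is continuous, so kernels centred at [x] recover its value there; the
    integrals that converge to it involve only [g]. *)
Lemma iter_bdiff_cvg l h u g x : 0 < h -> Cper 0 u -> is_weak_deriv l u g ->
  (fun n => intab 0 1 (fun y => g y * iter l (avg h) (rho_ n x) y)) @ \oo -->
    iter l (bdiff h) u x.
Proof.
move=> h0 Cu ug; under eq_fun do rewrite -(weak_deriv_iter_bdiff l h u g _ h0 Cu ug (Crho _ _)).
exact: coskernel_cvg (Cper_iter_bdiff 0 l h u Cu).
Qed.

Lemma iter_bdiff_norm_le l h u g M x : 0 < h -> Cper 0 u -> is_weak_deriv l u g ->
  0 <= M -> {ae unit, forall y, `|g y| <= M} ->
  `|iter l (bdiff h) u x| <= M * h ^+ l.
Proof.
move=> h0 Cu ug M0 gM; have [_ ig _] := ug; move/Lfun1_integrable : ig => ig.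
have /cvg_norm := iter_bdiff_cvg l h u g x h0 Cu ug.
move=> /ler_cvg_to; apply; first exact: (@cvg_cst _ (M * h ^+ l)).
apply: nearW => n /=; rewrite -(intab_iter_rho l h n x (ltW h0)).
by apply: norm_intabM_le => //; exact/bmeas_iter_rho/ltW.
Qed.

Lemma cvg_sum_seq (I : Type) (s : seq I) (F : I -> nat -> R) (L : I -> R) :
  (forall i, F i @ \oo --> L i) ->
  (fun n => \sum_(i <- s) F i n) @ \oo --> \sum_(i <- s) L i.
Proof.
move=> FL; elim: s => [|i s ih].
  by under eq_fun do rewrite big_nil; rewrite big_nil; exact: cvg_cst.
by under eq_fun do rewrite big_cons; rewrite big_cons; exact: cvgD.
Qed.

(** The factor [h ^+ l.+1] is the mass of each weight in Cauchy-Schwarz. The factor [h ^+ l] is the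
    sum of the [N] weights, which uses up one of the [l.+1] averages to tile the period. *)
Lemma sum_sq_iter_bdiff_le l N u g : (0 < N)%N -> Cper 0 u -> is_weak_deriv l.+1 u g ->
  mu.-integrable `[0, 1] (EFin \o (fun x => g x ^+ 2)) ->
  \sum_(1 <= m < N.+1) iter l.+1 (bdiff N%:R^-1) u (m%:R * N%:R^-1) ^+ 2 <=
  N%:R^-1 ^+ l.+1 * N%:R^-1 ^+ l * intab 0 1 (fun x => g x ^+ 2).
Proof.
move=> N0 Cu ug ig2; have [_ ig _] := ug.
have {}ig := integrable_unit _ (proj1 (Lfun1_integrable _ _) ig).
set h := N%:R^-1; have h0 : 0 < h by rewrite invr_gt0 ltr0n.
pose s m n := intab 0 1 (fun y => g y * iter l.+1 (avg h) (rho_ n (m%:R * h)) y).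
have sc : (fun n => \sum_(1 <= m < N.+1) s m n ^+ 2) @ \oo -->
    \sum_(1 <= m < N.+1) iter l.+1 (bdiff h) u (m%:R * h) ^+ 2.
  apply: cvg_sum_seq => m; apply: cvgM; exact: iter_bdiff_cvg.
move/ler_cvg_to : sc; apply; first exact: (@cvg_cst _ (h ^+ l.+1 * h ^+ l * intab 0 1 (fun x => g x ^+ 2))).
apply: nearW => n.
apply: (@le_trans _ _ (\sum_(1 <= m < N.+1) (h ^+ l.+1 *
    intab 0 1 (fun y => g y ^+ 2 * iter l.+1 (avg h) (rho_ n (m%:R * h)) y)))).
  apply: ler_sum => m _; apply: sq_intabM_le => //.
  - exact/bmeas_iter_rho/ltW.
  - exact: exprn_gt0.
  - by rewrite intab_iter_rho// ltW.
rewrite -mulr_sumr -mulrA ler_wpM2l ?exprn_ge0 ?(ltW h0)//.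
rewrite (Rintegral_sumM _ _ (fun m => iter l.+1 (avg h) (rho_ n (m%:R * h))))//; last first.
  by move=> m; exact/bmeas_iter_rho/ltW.
rewrite le_eqVlt; apply/orP; left; apply/eqP.
have bk : bmeas (@coskernel R n) := Cper_bmeas _ _ (Cper_coskernel n 0%N).
have pk : periodic (@coskernel R n) 1 := Cper_periodic _ _ (Cper_coskernel n 0%N).
(* The sum of the translated weights is independent of [x]: the outermost average tiles a period,
   leaving the mass of the [l] inner ones. *)
under eq_intab => x _.
  under eq_bigr do rewrite /rho_ iter_avg_shift iterS.
  rewrite sum_avg_shift//; last 2 first.
  - exact/bmeas_iter_avg/bk/ltW.
  - exact: periodic_iter_avg.
  rewrite (intab_iter_avg _ _ _ (ltW h0) bk pk) intab_coskernel mulr1.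
  over.
rewrite mulrC /intab RintegralZr//.
Qed.

End DifferenceQuotients.

(** * Periodized B-splines *)

Section PeriodicSplines.
Local Open Scope classical_set_scope.
Context {R : realType}.
Implicit Types (f g u v w : R -> R) (a c h x y : R) (k n N M : nat).
Local Notation mu := (@lebesgue_measure R).

Lemma bspline1E x : bspline 1 x = (- 2^-1 <= x <= 2^-1)%R%:R :> R.
Proof. by rewrite /bspline /= /bspline1 indicE mem_setE in_itv. Qed.

Lemma bmeas_bspline1 : bmeas (bspline 1 : R -> R).
Proof.
split; first exact: measurable_indic.
by exists 1 => x; rewrite bspline1E normr_nat lern1 leq_b1.
Qed.

(** Convolving with the indicator of an interval of length 1 centred at 0 averages over the unit
    interval centred at [x], whose left end is [x - 1/2]. *)
Lemma bsplineSE n x : bmeas (bspline n.+1 : R -> R) ->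
  bspline n.+2 x = avg 1 (bspline n.+1) (x - 2^-1).
Proof.
move=> bb; rewrite /bspline /= -/(bspline n.+1) /convolution.
have := intab_shift (x - 2^-1) 0 1 _ bb.
under [X in _ = X -> _]eq_intab do rewrite addrC.
rewrite -/(avg _ _ _) => <-.
rewrite /intab [RHS]Rintegral_mkcond; congr Rintegral; apply/funext => y.
rewrite patchE /bspline1 indicE !mem_setE !in_itv/= add0r.
have -> : (- 2^-1 <= x - y <= 2^-1) = (x - 2^-1 <= y <= 1 + (x - 2^-1)).
  by apply/andP/andP => -[? ?]; split; lra.
by case: ifP => _; rewrite ?mulr1 ?mulr0.
Qed.

Lemma bmeas_bspline n : bmeas (bspline n.+1 : R -> R).
Proof.
elim: n => [|n ih]; first exact: bmeas_bspline1.
have -> : bspline n.+2 = (fun x => avg 1 (bspline n.+1) (x - 2^-1)).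
  by apply/funext => x; exact: bsplineSE.
by apply: bmeas_shiftB; exact: bmeas_avg.
Qed.

Lemma bspline_ge0 n x : 0 <= bspline n.+1 x :> R.
Proof.
elim: n x => [|n ih] x; first by rewrite bspline1E.
by rewrite bsplineSE; [exact: avg_ge0|exact: bmeas_bspline].
Qed.

(* Twice the true support radius, which is enough for local finiteness. *)
Lemma bspline_support n x : n.+1%:R < `|x| -> bspline n.+1 x = 0 :> R.
Proof.
elim: n x => [|n ih] x xn.
  rewrite bspline1E; case: andP => // -[x1 x2].
  have : `|x| <= 2^-1 by rewrite ler_norml x1.
  lra.
rewrite bsplineSE; last exact: bmeas_bspline.
transitivity (intab 0 1 (cst (0 : R))); last by rewrite intab_cst// mul0r.
apply: eq_intab => t /andP[t0 t1]; rewrite ih//.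
have : `|t - 2^-1| <= 2^-1 by rewrite ler_norml; apply/andP; split; lra.
have := ler_normB (x - 2^-1 + t) (t - 2^-1).
rewrite (_ : x - 2^-1 + t - (t - 2^-1) = x); last by ring.
move: xn; rewrite -(natr1 n.+1); lra.
Qed.

Definition int_range M : seq int := [seq i%:Z - M%:Z | i <- iota 0 (2 * M).+1].

Lemma uniq_int_range M : uniq (int_range M).
Proof. by rewrite map_inj_uniq ?iota_uniq// => i j; lia. Qed.

Lemma mem_int_range M (z : int) : (z \in int_range M) = (`|z|%N <= M)%N.
Proof.
apply/mapP/idP => [[i] |zM]; first by rewrite mem_iota => ? ->; lia.
by exists (absz (z + M%:Z)%R); [rewrite mem_iota|]; lia.
Qed.

(** The periodization is written in the mesh variable [y = N * x], where cells have length 1 and the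
    period is [N]. *)
Definition perspl N n (y : R) : R :=
  \sum_(l \in [set: int]) bspline n (y - l%:~R * N%:R).

(** Terms with [|l| > M] vanish by [bspline_support], since [|l * N| >= |l|]. One finite range thus
    serves a whole bounded interval of [y], so the sum can be exchanged with integrals. *)
Lemma persplE N n M y : (0 < N)%N -> `|y| + n.+1%:R < M%:R ->
  perspl N n.+1 y = \sum_(l <- int_range M) bspline n.+1 (y - l%:~R * N%:R).
Proof.
move=> N0 yM; rewrite fsbig_seq ?uniq_int_range//; apply/esym.
apply: fsbig_widen => // z [_] /= /negP; rewrite mem_int_range -ltnNge => Mz.
apply: bspline_support.
have : M%:R <= `|z%:~R * N%:R| :> R.
  rewrite normrM normr_nat -intr_norm -natr_absz -natrM ler_nat.
  by rewrite (leq_trans (ltnW Mz))// leq_pmulr.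
have := ler_normB y (y - z%:~R * N%:R); rewrite opprB addrC subrK.
lra.
Qed.

Lemma perspl_periodic N n y : perspl N n (y + N%:R) = perspl N n y.
Proof.
rewrite /perspl [LHS](reindex_fsbigT (fun l : int => l + 1)).
  by apply: eq_fsbigr => z _; congr bspline; rewrite intrD; ring.
by exists (fun z : int => z - 1) => z; rewrite ?addrK ?subrK.
Qed.

Lemma perspl_ge0 N n y : 0 <= perspl N n.+1 y.
Proof.
rewrite /perspl; apply: fsumr_ge0 => l _; exact: bspline_ge0.
Qed.


Lemma persplSE N n y : (0 < N)%N ->
  perspl N n.+2 y = avg 1 (perspl N n.+1) (y - 2^-1).
Proof.
(* Large enough for order [n.+2] at [y] and for order [n.+1] at every point within [1/2] of [y]. *)
move=> N0; set M := Num.bound (`|y| + n.+3%:R : R).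
have yM : `|y| + n.+3%:R < M%:R by apply: archi_boundP; rewrite addr_ge0.
have n3 : n.+3%:R = n.+1%:R + 2 :> R by rewrite -natrD addn2.
rewrite (persplE _ _ M)//; last first.
  by move: yM; rewrite n3 -[n.+2%:R]natr1; lra.
transitivity (\sum_(z <- int_range M)
    intab 0 1 (fun t => bspline n.+1 (y - 2^-1 + t - z%:~R * N%:R) : R)).
  apply: eq_bigr => z _; rewrite bsplineSE; last exact: bmeas_bspline.
  by apply: eq_intab => t _; congr bspline; ring.
rewrite -intab_sum//; last first.
  move=> z; apply: (bmeas_addl (y - 2^-1) (fun t => bspline n.+1 (t - z%:~R * N%:R))).
  exact/bmeas_shiftB/bmeas_bspline.
apply: eq_intab => t /andP[t0 t1]; rewrite (persplE _ _ M)//.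
have : `|t - 2^-1| <= 2^-1 by rewrite ler_norml; apply/andP; split; lra.
have := ler_normD y (t - 2^-1); rewrite addrA addrAC.
by move: yM; rewrite n3; lra.
Qed.

Lemma measurable_perspl N n : (0 < N)%N ->
  measurable_fun setT (perspl N n.+1 : R -> R).
Proof.
move=> N0; apply: (@measurable_fun_cvg _ _ _ _
  (fun M y => \sum_(l <- int_range M) bspline n.+1 (y - l%:~R * N%:R)) (perspl N n.+1)).
  move=> M; apply: measurable_sum => l.
  by have [] := bmeas_shiftB (l%:~R * N%:R) _ (bmeas_bspline n).
move=> y _; set M := Num.bound (`|y| + n.+1%:R : R).
apply: cvg_near_cst; exists M => // K /= MK; apply/esym/persplE => //.
apply: lt_le_trans (archi_boundP _) _; first by rewrite addr_ge0.
by rewrite ler_nat.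
Qed.

(** Uniqueness of division by [N] with remainders in [1, ..., N]; it makes the translates below
    pairwise distinct. *)
Lemma eq_add_mul_nat N (a b : nat) (p q : int) :
  (0 < a < N.+1)%N -> (0 < b < N.+1)%N ->
  a%:Z + p * N%:Z = b%:Z + q * N%:Z -> (a, p) = (b, q).
Proof.
move=> aN bN e; have pq : p = q.
  have [pq|pq|//] := ltgtP p q; exfalso.
    have : 0 <= (q - p - 1) * N%:Z by rewrite mulr_ge0//; lia.
    by rewrite !mulrBl mul1r; lia.
  have : 0 <= (p - q - 1) * N%:Z by rewrite mulr_ge0//; lia.
  by rewrite !mulrBl mul1r; lia.
by move: e; rewrite pq => /addIr -[->].
Qed.

(* The bound is not [1]: the closed intervals overlap at the knots. *)
Lemma sum_perspl1_le N y : (0 < N)%N ->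
  \sum_(1 <= j < N.+1) perspl N 1 (y - j%:R) <= 2.
Proof.
move=> N0; set M := Num.bound (`|y| + N%:R + 1 : R).
have yM : `|y| + N%:R + 1 < M%:R by apply: archi_boundP; rewrite !addr_ge0.
pose L := [seq j%:Z + l * N%:Z | j <- index_iota 1 N.+1, l <- int_range M].
have -> : \sum_(1 <= j < N.+1) perspl N 1 (y - j%:R) =
    \sum_(m <- L) bspline 1 (y - m%:~R).
  rewrite big_allpairs_dep /= !big_seq; apply: eq_bigr => j.
  rewrite mem_index_iota => /andP[j1 jN].
  rewrite (persplE _ _ M)//.
    by apply: eq_bigr => l _; congr bspline; rewrite intrD intrM; ring.
  have := ler_normB y j%:R; rewrite normr_nat.
  have : j%:R <= N%:R :> R by rewrite ler_nat -ltnS.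
  lra.
have uL : uniq L.
  apply: allpairs_uniq; [exact: iota_uniq|exact: uniq_int_range|].
  move=> [j1 l1] [j2 l2] /allpairsP[[a b] [ha _ [-> ->]]].
  move=> /allpairsP[[c d] [hc _ [-> ->]]] e.
  by move: ha hc; rewrite !mem_index_iota => ha hc; exact: (@eq_add_mul_nat N).
(* An integer within [1/2] of [y] is either [k] or [k + 1], and each occurs at most once in [L]. *)
pose k := Num.ceil (y - 2^-1).
apply: (@le_trans _ _ (\sum_(m <- L) ((m == k)%:R + (m == k + 1)%:R))).
  apply: ler_sum => m _; rewrite bspline1E -natrD ler_nat.
  case: andP => // -[m1 m2].
  have : (k <= m)%R by rewrite ceil_le_int; lra.
  have : (m < k + 2)%R.
    rewrite -(ltr_int R) intrD; have := ceil_ge (y - 2^-1); rewrite -/k; lra.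
  move=> ? ?; have [->|->] : m = k \/ m = k + 1 by lia.
    by rewrite eqxx leq_addr.
  by rewrite eqxx leq_addl.
have cnt (z : int) : \sum_(m <- L) (m == z)%:R <= 1 :> R.
  rewrite -natr_sum -[X in _ <= X]/(1%:R) ler_nat.
  have -> : (\sum_(m <- L) (m == z))%N = count_mem z L.
    by rewrite -sum1_count [RHS]big_mkcond; apply: eq_bigr => m _ /=; case: eqP.
  by rewrite count_uniq_mem// leq_b1.
by rewrite big_split /=; have := cnt k; have := cnt (k + 1); lra.
Qed.

End PeriodicSplines.

(** * Spline series *)

Section SplineSeries.
Local Open Scope classical_set_scope.
Context {R : realType}.
Implicit Types (f g u v w : R -> R) (a c h x y : R) (k n N M : nat).
Local Notation mu := (@lebesgue_measure R).

(** The bound on the sum is a hypothesis because the two facts are proved in alternation: the sum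
    bound at order [n.+2] uses boundedness at order [n.+1]. *)
Lemma perspl_bound N n : (0 < N)%N ->
  (forall y, \sum_(1 <= j < N.+1) perspl N n.+1 (y - j%:R) <= 2) ->
  bmeas (perspl N n.+1 : R -> R).
Proof.
move=> N0 s2; split; first exact: measurable_perspl.
exists 2 => y; rewrite ger0_norm ?perspl_ge0//.
apply: le_trans (s2 (y + 1)); rewrite big_ltn// addrK lerDl.
by apply: sumr_ge0 => j _; exact: perspl_ge0.
Qed.

(** Raising the order averages the whole sum over an interval of length 1, which preserves the
    bound. *)
Lemma sum_perspl_le N n y : (0 < N)%N ->
  \sum_(1 <= j < N.+1) perspl N n.+1 (y - j%:R) <= 2.
Proof.
move=> N0; elim: n y => [|n ih] y; first exact: sum_perspl1_le.
have bp := perspl_bound N n N0 ih.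
have bpj (j : nat) : bmeas (fun t => perspl N n.+1 (y - 2^-1 - j%:R + t) : R).
  exact: (bmeas_addl (y - 2^-1 - j%:R)).
rewrite (eq_bigr (fun j : nat => intab 0 1 (fun t => perspl N n.+1 (y - 2^-1 - j%:R + t)))); last first.
  by move=> j _; rewrite persplSE// /avg; apply: eq_intab => t _; congr perspl; ring.
rewrite -(intab_sum _ _ (fun (j : nat) t => perspl N n.+1 (y - 2^-1 - j%:R + t)))//.
apply: (@le_trans _ _ (intab 0 1 (cst 2))); last by rewrite intab_cst// subr0 mulr1.
apply: le_intab => //; [exact: bmeas_sum|exact: bmeas_cst|move=> t _].
rewrite /cst; apply: le_trans (ih (y - 2^-1 + t)).
by rewrite le_eqVlt; apply/orP; left; apply/eqP; apply: eq_bigr => j _; congr perspl; ring.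
Qed.

Lemma bmeas_perspl N n : (0 < N)%N -> bmeas (perspl N n.+1 : R -> R).
Proof. by move=> N0; apply: perspl_bound => // y; exact: sum_perspl_le. Qed.

(** Coefficients are kept as samples of a function, so that differencing them is [bdiff] and
    periodicity of [u] handles the wrap-around. *)
Definition spl N n u y : R :=
  \sum_(1 <= j < N.+1) u (j%:R * N%:R^-1) * perspl N n (y - j%:R).

Lemma spl_periodic N n u y : spl N n u (y + N%:R) = spl N n u y.
Proof.
by apply: eq_bigr => j _; rewrite addrAC perspl_periodic.
Qed.

Lemma bmeas_spl N n u : (0 < N)%N -> bmeas (spl N n.+1 u).
Proof.
move=> N0; apply: bmeas_sum => j; apply: bmeasZ.
exact/bmeas_shiftB/bmeas_perspl.
Qed.

Lemma bmeas_spl_affine N n u a : (0 < N)%N -> bmeas (fun x => spl N n.+1 u (N%:R * x - a)).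
Proof. by move=> N0; apply: (bmeas_affine N%:R (- a)); exact: bmeas_spl. Qed.

Lemma periodic_spl_affine N n u a : periodic (fun x => spl N n u (N%:R * x - a)) 1.
Proof. by move=> x; rewrite mulrDr mulr1 addrAC spl_periodic. Qed.

Lemma splD1B N n u y : (0 < N)%N -> periodic u 1 ->
  spl N n u (y + 1) - spl N n u y = spl N n (bdiff N%:R^-1 u) (y + 1).
Proof.
move=> N0 pu; pose G (j : nat) := u (j%:R * N%:R^-1) * perspl N n (y - j%:R).
have NN : N%:R * N%:R^-1 = 1 :> R by rewrite mulfV// pnatr_eq0 -lt0n.
(* The index range is shifted down by one: the term [j = N] becomes [j = 0], by periodicity of both
   [u] and [perspl]. *)
have -> : spl N n u y = \sum_(1 <= j < N.+1) G j.-1.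
  rewrite big_add1/= big_ltn// /spl big_nat_recr//= addrC; congr (_ + _).
  rewrite /G NN !mul0r subr0 -[u 0]pu add0r; congr (_ * _).
  by rewrite -(perspl_periodic N n (y - N%:R)) subrK.
rewrite /spl -sumrB big_nat [RHS]big_nat; apply: eq_bigr => -[//|j] _.
rewrite /G /= /bdiff mulrBl; congr (_ - u _ * perspl _ _ _).
  by rewrite -natr1 mulrDl mul1r addrK.
by rewrite -natr1; ring.
Qed.

(** The order [n.+2] series is [N] times the average over one cell of the order [n.+1] series [F].
    The B-spline recursion moves the centre to [a + 1/2], and the unit step in [splD1B] brings it to
    [a - 1/2]. *)
Lemma spl_weak_deriv1 N n u a : (0 < N)%N -> periodic u 1 ->
  is_weak_deriv 1 (fun x => spl N n.+2 u (N%:R * x - a))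
    (fun x => N%:R * spl N n.+1 (bdiff N%:R^-1 u) (N%:R * x - (a - 2^-1))).
Proof.
move=> N0 pu; have N0' : 0 < N%:R :> R by rewrite ltr0n.
have h0 : 0 < N%:R^-1 :> R by rewrite invr_gt0.
pose F x := spl N n.+1 u (N%:R * x - (a + 2^-1)).
have bF : bmeas F by exact: bmeas_spl_affine.
have pF : periodic F 1 by exact: periodic_spl_affine.
have -> : (fun x => spl N n.+2 u (N%:R * x - a)) = (fun x => N%:R * avg N%:R^-1 F x).
  apply/funext => x.
  have bb y : bmeas (fun t => perspl N n.+1 (y + t) : R).
    by apply: bmeas_addl; exact: bmeas_perspl.
  rewrite /avg.
  have bx : bmeas (fun t => spl N n.+1 u (N%:R * x - (a + 2^-1) + t)).
    by apply: bmeas_addl; exact: bmeas_spl.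
  transitivity (intab 0 1 (fun t => spl N n.+1 u (N%:R * x - (a + 2^-1) + t))); last first.
    have := intab_affine N%:R 0 0 N%:R^-1 _ N0' bx.
    rewrite mulr0 !addr0 mulfV ?gt_eqF// => ->; congr (_ * _).
    by apply: eq_intab => t _; rewrite /F; congr spl; ring.
  rewrite /spl intab_sum//; last first.
    by move=> j; apply: bmeasZ; under eq_fun do rewrite addrAC; exact: bb.
  apply: eq_bigr => j _; rewrite intabZ; last by under eq_fun do rewrite addrAC; exact: bb.
  rewrite persplSE// /avg; congr (_ * _); apply: eq_intab => t _; congr perspl; ring.
have -> : (fun x => N%:R * spl N n.+1 (bdiff N%:R^-1 u) (N%:R * x - (a - 2^-1))) =
    (fun x => N%:R * fdiff N%:R^-1 F x).
  apply/funext => x; rewrite /fdiff /F; congr (_ * _).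
  have -> : N%:R * (x + N%:R^-1) - (a + 2^-1) = N%:R * x - (a + 2^-1) + 1.
    by field; rewrite gt_eqF.
  by rewrite splD1B//; congr spl; field.
apply: (weak_derivZ 1 N%:R (avg N%:R^-1 F) (fdiff N%:R^-1 F)).
- exact/bmeas_avg/bF/ltW.
- exact: bmeas_fdiff.
- exact: weak_deriv_avg.
Qed.

Lemma spl_weak_deriv l N n u a : (0 < N)%N -> periodic u 1 ->
  is_weak_deriv l (fun x => spl N (l + n).+1 u (N%:R * x - a))
    (fun x => N%:R ^+ l * spl N n.+1 (iter l (bdiff N%:R^-1) u) (N%:R * x - (a - l%:R / 2))).
Proof.
move=> N0 pu; elim: l n => [|l ih] n.
  under [X in is_weak_deriv _ _ X]eq_fun do rewrite mul1r mul0r subr0.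
  by apply: weak_deriv0; [exact: bmeas_spl_affine|exact: periodic_spl_affine].
have := ih n.+1; rewrite addnS -addSn => /weak_deriv_comp; apply.
have pl : periodic (iter l (bdiff N%:R^-1) u) 1.
  by elim: (l) => [//|k ik] /=; exact: periodic_bdiff.
have := weak_derivZ 1 (N%:R ^+ l) _ _ _ _ (spl_weak_deriv1 N n _ (a - l%:R / 2) N0 pl).
move=> /(_ (bmeas_spl_affine _ _ _ _ N0) (bmeasZ _ _ (bmeas_spl_affine _ _ _ _ N0))).
congr is_weak_deriv; apply/funext => x /=.
rewrite mulrA -exprSr; congr (_ * spl _ _ _ (_ - _)).
by rewrite -natr1; field.
Qed.

(** Discrete counterpart of [sq_intabM_le], by the same completed square. *)
Lemma wsq_sum_le (I : Type) (s : seq I) (b c : I -> R) (K : R) : 0 < K ->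
  (forall i, 0 <= b i) -> \sum_(i <- s) b i <= K ->
  (\sum_(i <- s) c i * b i) ^+ 2 <= K * \sum_(i <- s) c i ^+ 2 * b i.
Proof.
move=> K0 b0 bK; set X := \sum_(i <- s) c i * b i; set Y := \sum_(i <- s) c i ^+ 2 * b i.
pose t := X / K; have tK : t * K = X by rewrite /t divfK// gt_eqF.
have : 0 <= \sum_(i <- s) (c i - t) ^+ 2 * b i.
  by apply: sumr_ge0 => i _; rewrite mulr_ge0// sqr_ge0.
rewrite (eq_bigr (fun i => c i ^+ 2 * b i - (2 * t * (c i * b i) - t ^+ 2 * b i))); last by move=> i _; ring.
rewrite !sumrB -!mulr_sumr -/X -/Y => h.
have h2 : t ^+ 2 * \sum_(i <- s) b i <= t ^+ 2 * K by rewrite ler_wpM2l// sqr_ge0.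
have : 0 <= K * (Y - (2 * t * X - t ^+ 2 * K)) by rewrite mulr_ge0//; [exact: ltW|lra].
rewrite -tK; lra.
Qed.

Lemma spl_norm_le N n u y K : (0 < N)%N -> (forall x, `|u x| <= K) ->
  `|spl N n.+1 u y| <= 2 * K.
Proof.
move=> N0 uK; have K0 : 0 <= K by exact: le_trans (uK 0).
apply: le_trans (ler_norm_sum _ _ _) _.
apply: (@le_trans _ _ (\sum_(1 <= j < N.+1) K * perspl N n.+1 (y - j%:R))).
  apply: ler_sum => j _; rewrite normrM (ger0_norm (perspl_ge0 _ _ _)).
  by rewrite ler_wpM2r ?perspl_ge0.
by rewrite -mulr_sumr mulrC ler_wpM2r// sum_perspl_le.
Qed.

(* By translation invariance the [N] shifts have equal integrals, and the shifts
   sum to at most [2]. *)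
Lemma intab_perspl_le N n c : (0 < N)%N ->
  N%:R * intab 0 1 (fun x => perspl N n.+1 (N%:R * x - c)) <= 2.
Proof.
move=> N0; have N0' : 0 < N%:R :> R by rewrite ltr0n.
pose P x := perspl N n.+1 (N%:R * x - c).
have bP : bmeas P by apply: (bmeas_affine N%:R (- c)); exact: bmeas_perspl.
have pP : periodic P 1.
  by move=> x; rewrite /P mulrDr mulr1 addrAC perspl_periodic.
have -> : N%:R * intab 0 1 P = \sum_(1 <= j < N.+1) intab 0 1 (fun x => P (x - j%:R / N%:R)).
  rewrite (eq_bigr (fun=> intab 0 1 P)); last by move=> j _; exact: intab_periodic.
  by rewrite sumr_const_nat subn1 mulr_natl.
rewrite -intab_sum//; last by move=> j; exact: bmeas_shiftB.
apply: (@le_trans _ _ (intab 0 1 (cst 2))); last by rewrite intab_cst// subr0 mulr1.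
apply: le_intab => //; [by apply: bmeas_sum => j; exact: bmeas_shiftB|exact: bmeas_cst|].
move=> x _; apply: le_trans (sum_perspl_le N n (N%:R * x - c) N0).
rewrite le_eqVlt; apply/orP; left; apply/eqP; apply: eq_bigr => j _.
by rewrite /P; congr perspl; field; rewrite gt_eqF.
Qed.

(** Pointwise Cauchy-Schwarz with the B-splines as weights gives one factor 2; the integral of each
    weight is at most [2 / N]. *)
Lemma intab_sq_spl_le N n u a : (0 < N)%N ->
  intab 0 1 (fun x => spl N n.+1 u (N%:R * x - a) ^+ 2) <=
  4 / N%:R * \sum_(1 <= j < N.+1) u (j%:R * N%:R^-1) ^+ 2.
Proof.
move=> N0; have N0' : 0 < N%:R :> R by rewrite ltr0n.
have bj (j : nat) : bmeas (fun x => perspl N n.+1 (N%:R * x - (a + j%:R)) : R).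
  by apply: (bmeas_affine N%:R (- _)); exact: bmeas_perspl.
pose c (j : nat) := u (j%:R * N%:R^-1).
pose G x := \sum_(1 <= j < N.+1) (2 * c j ^+ 2) * perspl N n.+1 (N%:R * x - (a + j%:R)).
apply: (@le_trans _ _ (intab 0 1 G)).
  apply: le_intab => //.
  - by apply: bmeasM; exact: bmeas_spl_affine.
  - by apply: bmeas_sum => j; exact: bmeasZ.
  move=> x _; rewrite /spl.
  have := wsq_sum_le _ (index_iota 1 N.+1) (fun j => perspl N n.+1 (N%:R * x - a - j%:R))
    c 2 (ltr0Sn R 1) (fun j => perspl_ge0 _ _ _) (sum_perspl_le N n (N%:R * x - a) N0).
  move=> /le_trans; apply; rewrite mulr_sumr le_eqVlt; apply/orP; left; apply/eqP.
  by apply: eq_bigr => j _; rewrite mulrA opprD addrA.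
rewrite /G intab_sum//; last by move=> j; exact: bmeasZ.
rewrite mulr_sumr; apply: ler_sum => j _; rewrite intabZ//.
have := intab_perspl_le N n (a + j%:R) N0; rewrite -ler_pdivlMl// => h.
apply: le_trans (ler_wpM2l _ h) _; first by rewrite mulr_ge0// sqr_ge0.
by rewrite le_eqVlt; apply/orP; left; apply/eqP; rewrite /c; field; rewrite gt_eqF.
Qed.

End SplineSeries.

(** * The quasiinterpolant *)

Section QuasiInterpolant.
Local Open Scope classical_set_scope.
Context {R : realType}.
Implicit Types (f g u v w : R -> R) (a c h x y : R) (l k n r N M : nat) (q : nat -> R).
Local Notation mu := (@lebesgue_measure R).

(** Pairs of a coefficient and an index shift: the symmetric stencil becomes a single list, and
    results on one spline series extend by linearity. *)
Definition qterms r q : seq (R * int) :=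
  (q 0%N, 0) :: flatten [seq [:: (q k, k%:Z); (q k, - k%:Z)] | k <- index_iota 1 r].

Definition qnorm r q : R := \sum_(p <- qterms r q) `|p.1|.

Lemma qnorm_ge0 r q : 0 <= qnorm r q.
Proof. by apply: sumr_ge0. Qed.

Lemma Phi_E r N (j : int) x :
  Phi_ r N j x = perspl N r (N%:R * x - (j%:~R + (r%:R - 2) / 2)).
Proof.
apply: eq_fsbigr => z _; rewrite /phi_ /mesh invrK; congr bspline.
by rewrite intrD intrM; ring.
Qed.

Lemma tPhiE r N q (j : int) x :
  tPhi r N q j x = \sum_(p <- qterms r q) p.1 * Phi_ r N (j + p.2) x.
Proof.
rewrite /tPhi /qterms big_cons /= addr0; congr (_ + _).
rewrite big_flatten /= big_map; apply: eq_bigr => k _.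
by rewrite !big_cons big_nil /= addr0 mulrDr.
Qed.

Lemma quasi_interpE r N q u x : quasi_interp r N q u x =
  \sum_(p <- qterms r q) p.1 * spl N r u (N%:R * x - (p.2%:~R + (r%:R - 2) / 2)).
Proof.
rewrite /quasi_interp; under eq_bigr do rewrite tPhiE mulr_sumr.
rewrite exchange_big /=; apply: eq_bigr => p _; rewrite /spl mulr_sumr.
apply: eq_bigr => j _; rewrite Phi_E mulrCA; congr (_ * (_ * perspl _ _ _)).
by rewrite intrD; ring.
Qed.

(** Explicit representative of the [l]-th derivative of the quasiinterpolant; every derivative
    lowers the order by one and moves the centre by [1/2]. *)
Definition qderiv r N q u l (x : R) : R :=
  \sum_(p <- qterms r q) p.1 * (N%:R ^+ l *
    spl N (r - l) (iter l (bdiff N%:R^-1) u)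
      (N%:R * x - (p.2%:~R + (r%:R - 2) / 2 - l%:R / 2))).

Lemma qderiv0 r N q u : qderiv r N q u 0 = quasi_interp r N q u.
Proof.
apply/funext => x; rewrite quasi_interpE; apply: eq_bigr => p _.
by rewrite mul1r mul0r subr0 subn0.
Qed.

Lemma bmeas_qderiv r N q u l : (0 < N)%N -> (l < r)%N -> bmeas (qderiv r N q u l).
Proof.
move=> N0 lr; apply: bmeas_sum => p; do 2 apply: bmeasZ.
by rewrite -(subnSK lr); exact: bmeas_spl_affine.
Qed.

Lemma quasi_interp_weak_deriv r N q u l : (0 < N)%N -> (l < r)%N -> periodic u 1 ->
  is_weak_deriv l (quasi_interp r N q u) (qderiv r N q u l).
Proof.
move=> N0 lr pu.
have -> : quasi_interp r N q u = (fun x => \sum_(p <- qterms r q)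
    p.1 * spl N (l + (r - l.+1)).+1 u (N%:R * x - (p.2%:~R + (r%:R - 2) / 2))).
  by apply/funext => x; rewrite quasi_interpE -addnS subnSK// subnKC// ltnW.
rewrite /qderiv -(subnSK lr).
apply: (weak_deriv_sum _ (qterms r q) l
  (fun p x => p.1 * spl N (l + (r - l.+1)).+1 u (N%:R * x - (p.2%:~R + (r%:R - 2) / 2)))
  (fun p x => p.1 * (N%:R ^+ l * spl N (r - l.+1).+1 (iter l (bdiff N%:R^-1) u)
      (N%:R * x - (p.2%:~R + (r%:R - 2) / 2 - l%:R / 2))))) => p.
- exact/bmeasZ/bmeas_spl_affine.
- exact/bmeasZ/bmeasZ/bmeas_spl_affine.
- apply: weak_derivZ; [exact: bmeas_spl_affine|exact/bmeasZ/bmeas_spl_affine|].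
  exact: spl_weak_deriv.
Qed.

Lemma qderiv_norm_le r N q u l K x : (0 < N)%N -> (l < r)%N ->
  (forall y, `|iter l (bdiff N%:R^-1) u y| <= K * N%:R^-1 ^+ l) ->
  `|qderiv r N q u l x| <= 2 * qnorm r q * K.
Proof.
move=> N0 lr uK; have N0' : 0 < N%:R :> R by rewrite ltr0n.
apply: le_trans (ler_norm_sum _ _ _) _.
rewrite mulrAC mulr_sumr; apply: ler_sum => p _.
rewrite normrM mulrC ler_wpM2r// normrM ger0_norm ?exprn_ge0//.
rewrite -(subnSK lr).
apply: le_trans (ler_wpM2l _ (spl_norm_le N _ _ _ _ N0 uK)) _; first exact: exprn_ge0.
rewrite le_eqVlt; apply/orP; left; apply/eqP.
by rewrite exprVn; field; rewrite expf_neq0// gt_eqF.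
Qed.

Lemma intab_sq_qderiv_le r N q u l : (0 < N)%N -> (l < r)%N ->
  intab 0 1 (fun x => qderiv r N q u l x ^+ 2) <=
  4 * (qnorm r q + 1) ^+ 2 * (N%:R ^+ l) ^+ 2 / N%:R *
    \sum_(1 <= j < N.+1) iter l (bdiff N%:R^-1) u (j%:R * N%:R^-1) ^+ 2.
Proof.
move=> N0 lr; have N0' : 0 < N%:R :> R by rewrite ltr0n.
set S := \sum_(1 <= j < N.+1) _; have S0 : 0 <= S.
  by apply: sumr_ge0 => j _; exact: sqr_ge0.
pose s (p : R * int) x := spl N (r - l) (iter l (bdiff N%:R^-1) u)
      (N%:R * x - (p.2%:~R + (r%:R - 2) / 2 - l%:R / 2)).
have bs p : bmeas (s p) by rewrite /s -(subnSK lr); exact: bmeas_spl_affine.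
have bs2 p : bmeas (fun x => s p x ^+ 2) by exact: bmeasM.
have A0 := qnorm_ge0 r q.
(* [wsq_sum_le] divides by its bound, so [1] is added to keep [A] positive even if all coefficients
   vanish. *)
pose A := qnorm r q + 1; have A1 : 0 < A by rewrite ltr_wpDl.
pose G x := \sum_(p <- qterms r q) (A * (N%:R ^+ l) ^+ 2 * `|p.1|) * s p x ^+ 2.
apply: (@le_trans _ _ (intab 0 1 G)).
  apply: le_intab.
  - by apply: bmeasM; exact: bmeas_qderiv.
  - by apply: bmeas_sum => p; exact: bmeasZ.
  move=> x _.
  apply: (@le_trans _ _ ((\sum_(p <- qterms r q) (N%:R ^+ l * `|s p x|) * `|p.1|) ^+ 2)).
    rewrite -[leLHS]real_normK ?num_real// lerXn2r ?nnegrE//.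
      by apply: sumr_ge0 => p _; rewrite !mulr_ge0// exprn_ge0.
    apply: le_trans (ler_norm_sum _ _ _) _.
    apply: ler_sum => p _; rewrite normrM normrM (ger0_norm (exprn_ge0 _ _))//.
    by rewrite mulrC.
  apply: le_trans (wsq_sum_le _ _ (fun p : R * int => `|p.1|) (fun p => N%:R ^+ l * `|s p x|) A A1 _ _) _ => //.
    by rewrite lerDl.
  rewrite mulr_sumr le_eqVlt; apply/orP; left; apply/eqP; apply: eq_bigr => p _.
  by rewrite exprMn real_normK ?num_real//; ring.
rewrite /G intab_sum//; last by move=> p; exact: bmeasZ.
apply: (@le_trans _ _ (\sum_(p <- qterms r q) (A * (N%:R ^+ l) ^+ 2 * `|p.1|) * (4 / N%:R * S))).
  apply: ler_sum => p _; rewrite intabZ// ler_wpM2l//.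
    by rewrite !mulr_ge0 ?sqr_ge0// ltW.
  by rewrite /s -(subnSK lr); exact: intab_sq_spl_le.
rewrite -mulr_suml -mulr_sumr -/(qnorm r q) -/A.
have -> : 4 * A ^+ 2 * (N%:R ^+ l) ^+ 2 / N%:R * S =
    A * (N%:R ^+ l) ^+ 2 * A * (4 / N%:R * S) by field; rewrite gt_eqF.
rewrite ler_wpM2r//; first by rewrite mulr_ge0// divr_ge0// ltW.
rewrite ler_wpM2l//; last by rewrite lerDl.
by rewrite mulr_ge0 ?sqr_ge0// ltW.
Qed.

(** The case [l = 0] is included: with [g = u] it is the stability of the quasiinterpolant
    itself. *)
Lemma qderiv_infty_le r N q u g l : (0 < N)%N -> (l < r)%N -> Cper 0 u ->
  is_weak_deriv l u g ->
  (Lpnorm +oo (qderiv r N q u l) <= (2 * (qnorm r q + 1))%:E * Lpnorm +oo g)%E.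
Proof.
move=> N0 lr Cu ug; have A0 := qnorm_ge0 r q.
(* Strict positivity is what makes the constant times [+oo] equal to [+oo]. *)
have C0 : 0 < 2 * (qnorm r q + 1) by rewrite mulr_gt0// ltr_wpDl.
have [->|[K [K0 -> gK]]] := Lpnorm_infty_cases g.
  by rewrite gt0_muley ?lte_fin// leey.
rewrite -EFinM; apply: Lpnorm_infty_le => x.
have h0 : 0 < N%:R^-1 :> R by rewrite invr_gt0 ltr0n.
have uK y := iter_bdiff_norm_le l _ u g K y h0 Cu ug K0 gK.
apply: le_trans (qderiv_norm_le r N q u l K x N0 lr uK) _.
by rewrite ler_wpM2r// ler_wpM2l// lerDl.
Qed.

Lemma qderiv_L2_le r N q u g l : (0 < N)%N -> (l.+1 < r)%N -> Cper 0 u ->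
  is_weak_deriv l.+1 u g ->
  (Lpnorm 2%:E (qderiv r N q u l.+1) <= (2 * (qnorm r q + 1))%:E * Lpnorm 2%:E g)%E.
Proof.
move=> N0 lr Cu ug; have A0 := qnorm_ge0 r q.
have C0 : 0 < 2 * (qnorm r q + 1) by rewrite mulr_gt0// ltr_wpDl.
have mg : measurable_fun setT g by have [_ /Lfun_measurable] := ug.
have [->|[ig2 ->]] := Lpnorm2_cases g mg.
  by rewrite gt0_muley ?lte_fin// leey.
rewrite Lpnorm2_bmeas; last exact: bmeas_qderiv.
have N0' : 0 < N%:R :> R by rewrite ltr0n.
rewrite -EFinM lee_fin -(ger0_norm (ltW C0)) -sqrtr_sqr -sqrtrM ?sqr_ge0// ler_wsqrtr//.
apply: le_trans (intab_sq_qderiv_le r N q u l.+1 N0 lr) _.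
have := sum_sq_iter_bdiff_le l N u g N0 Cu ug ig2.
move=> /(ler_wpM2l (_ : 0 <= 4 * (qnorm r q + 1) ^+ 2 * (N%:R ^+ l.+1) ^+ 2 / N%:R)) h.
apply: le_trans (h _) _.
  by rewrite divr_ge0 ?(ltW N0')// mulr_ge0 ?sqr_ge0// mulr_ge0 ?sqr_ge0.
(* All powers of [N] cancel: [2 * (l + 1) - 1] from the spline series against [(l + 1) + l] from the
   differences. *)
rewrite le_eqVlt; apply/orP; left; apply/eqP.
rewrite !exprVn !exprS; field.
by rewrite expf_neq0 gt_eqF.
Qed.

End QuasiInterpolant.

(** * Stability of the quasiinterpolant and of its derivatives *)

Theorem proposition6p1 (R : realType) (r : nat) (q : nat -> R)
  (hr : (2 <= r)%N)
  (hq : forall N : nat, (4 * r <= N)%N -> tPhi_is_basis r N q) :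
  (exists C0 : R, forall N : nat, (4 * r <= N)%N ->
     forall u : R -> R, Cper 0 u ->
       (Lpnorm +oo (quasi_interp r N q u) <= C0%:E * Lpnorm +oo u)%E) /\
  (forall l : nat, (1 <= l <= r - 1)%N ->
     exists C1 C2 : R, forall N : nat, (4 * r <= N)%N ->
       (forall u g : R -> R, W_infty l u -> H_per l u -> is_weak_deriv l u g ->
          exists2 w : R -> R, is_weak_deriv l (quasi_interp r N q u) w &
            (Lpnorm +oo w <= C1%:E * Lpnorm +oo g)%E) /\
       (forall u g : R -> R, H_per l u -> is_weak_deriv l u g ->
          exists2 w : R -> R, is_weak_deriv l (quasi_interp r N q u) w &
            (Lpnorm 2%:E w <= C2%:E * Lpnorm 2%:E g)%E)).
Proof.
have N_gt0 N : (4 * r <= N)%N -> (0 < N)%N by lia.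
split.
  exists (2 * (qnorm r q + 1)) => N /N_gt0 N0 u Cu.
  rewrite -qderiv0; apply: qderiv_infty_le => //; first lia.
  exact: weak_deriv0 (Cper_bmeas _ _ Cu) (Cper_periodic _ _ Cu).
move=> [//|l] lr; have {}lr : (l.+1 < r)%N by lia.
(* Both constants are chosen before [N] and depend only on [r] and [q]; the witness [qderiv] serves
   both norms. *)
exists (2 * (qnorm r q + 1)), (2 * (qnorm r q + 1)) => N /N_gt0 N0.
split=> u g.
  move=> [Cu _] _ ug; exists (qderiv r N q u l.+1); last exact: qderiv_infty_le.
  exact: quasi_interp_weak_deriv (Cper_periodic _ _ Cu).
move=> [Cu _] ug; exists (qderiv r N q u l.+1); last exact: qderiv_L2_le.
exact: quasi_interp_weak_deriv (Cper_periodic _ _ Cu).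
Qed.
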